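(* Let $p$ be a polynomial over $\mathbb{C}$ with $\deg(p)\ge2$ and let $P:\mathcal{M}(2,\mathbb{C})\to\mathcal{M}(2,\mathbb{C})$ be the corresponding matrix-valued polynomial. Then the Julia set $J_P$ and the Fatou set $F_P$ are completely invariant under $P$.
   Context: $\mathcal{M}(2,\mathbb{C})\cong\mathbb{C}^4$ is the space of $2\times 2$ complex matrices. For a polynomial $p(z)=a_kz^k+\cdots+a_1z+a_0$ over $\mathbb{C}$, the corresponding matrix-valued polynomial is $P(M)=a_kM^k+\cdots+a_1M+a_0\mathrm{Id}$; $P^n$ denotes the $n$-fold iterate. The Fatou set $F_P$ is the set of $M\in\mathcal{M}(2,\mathbb{C})$ having a neighborhood on which $\{P^n\}_{n\ge1}$ is a normal family, meaning that every sequence from the family has a subsequence which either converges uniformly on compact subsets to a holomorphic map or diverges uniformly on compact subsets to infinity. The Julia set is $J_P=\mathcal{M}(2,\mathbb{C})\setminus F_P$. A set $S$ is completely invariant under $P$ if for every $M$ one has $M\in S$ if and only if $P(M)\in S$. *)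

(* Defs.v *)
From HB Require Import structures.
From mathcomp Require Import all_boot all_order all_algebra.
From mathcomp Require Import complex.
From mathcomp Require Import all_classical all_reals all_analysis.

Set Implicit Arguments.
Unset Strict Implicit.
Unset Printing Implicit Defensive.

Import Order.TTheory GRing.Theory Num.Theory.
Import numFieldNormedType.Exports.

Local Open Scope classical_set_scope.
Local Open Scope ring_scope.

(* The definitions are given over an arbitrary [K : numFieldType], so that the
   library's normed-module structure on ['M[K]_2] is found; they are meant for
   [K = R[i]] with [R : realType].  The norm on ['M[K]_2] is the sup norm of the
   entries, and it takes its values in [K]. *)

Definition matrix_poly (K : numFieldType) (p : {poly K}) (M : 'M[K]_2) : 'M[K]_2 :=
  horner_mx M p.

(* [differentiable] is Frechet differentiability over [K]: for [K = R[i]] the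
   differential is complex linear. *)
Definition holomorphic_on (K : numFieldType) (U : set 'M[K]_2)
    (f : 'M[K]_2 -> 'M[K]_2) : Prop :=
  forall M, U M -> differentiable f M.

(* The order of [R[i]] is partial: [r < x] fails for every [x] when [r] is not
   real, hence the restriction on [r]. *)
Definition compactly_divergent (K : numFieldType) (U : set 'M[K]_2)
    (g : nat -> 'M[K]_2 -> 'M[K]_2) : Prop :=
  forall A, compactly_in U A -> forall r : K, r \is Num.real ->
    \forall k \near \oo, forall M, A M -> r < `|g k M|.

Definition normal_family (K : numFieldType) (U : set 'M[K]_2)
    (F : set ('M[K]_2 -> 'M[K]_2)) : Prop :=
  forall s : nat -> 'M[K]_2 -> 'M[K]_2, (forall k, F (s k)) ->
  exists phi : nat -> nat, {homo phi : i j / (i < j)%N} /\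
    ((exists f, holomorphic_on U f /\
        {family compactly_in U, (s \o phi) @ \oo --> f}) \/
     compactly_divergent U (s \o phi)).

Definition fatou_set (K : numFieldType) (P : 'M[K]_2 -> 'M[K]_2) : set 'M[K]_2 :=
  [set M | exists U, open_nbhs M U /\
     normal_family U [set iter n P | n in [set n | (1 <= n)%N]]].

Definition julia_set (K : numFieldType) (P : 'M[K]_2 -> 'M[K]_2) : set 'M[K]_2 :=
  ~` fatou_set P.

Definition completely_invariant (T : Type) (P : T -> T) (S : set T) : Prop :=
  forall M, S M <-> S (P M).

(* Main.v *)
(* [P^n (M)] is [p^n] applied to [M]: when [M] has eigenvalues [a], [b], it equals
   [p^n(a) + p^n[a, b] (M - a)] with [p^n[a, b]] the divided difference.  Let [K]
   be the filled Julia set of [p].  Then [M] is in the Fatou set if and only if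
   some eigenvalue escapes or all eigenvalues lie in the interior of [K].  If an
   eigenvalue escapes, [P^n] diverges uniformly near [M].  If all are interior,
   Cauchy's estimates bound the divided differences, hence [P^n], uniformly near
   [M], and a Montel argument applies.  If all eigenvalues are in [K] and one is
   on its boundary, arbitrarily close matrices have divergent orbits while others
   have bounded ones.  Since [P] maps the spectrum of [M] onto that of [P(M)], and
   both the escaping set and the interior of [K] are forward invariant (the latter
   by the open mapping property of [p]), the Fatou set is forward invariant.
   [P] itself need not be open, so forward invariance of the Fatou set is not
   a formal consequence of its definition; backward invariance is. *)

From HB Require Import structures.
Require Import Defs.
From mathcomp Require Import all_boot all_order all_algebra all_field.
From mathcomp Require Import complex zify ring.
From mathcomp Require Import all_classical all_reals all_analysis.

Set Implicit Arguments.
Unset Strict Implicit.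
Unset Printing Implicit Defensive.

Import Order.TTheory GRing.Theory Num.Theory.
Import numFieldNormedType.Exports.

Local Open Scope classical_set_scope.
Local Open Scope ring_scope.
Local Open Scope complex_scope.

(** * Polynomials over the complex numbers *)

Section ComplexPolynomials.
Variable C : numClosedFieldType.
Implicit Types (q g : {poly C}) (a z t B r : C).

Lemma exists_prim_root n : (0 < n)%N -> {w : C | n.-primitive_root w}.
Proof.
move=> n_gt0; have [rs def] := closed_field_poly_normal ('X^n - 1 : {poly C}).
have lead1 : lead_coef ('X^n - 1 : {poly C}) = 1 by apply/eqP; exact: monicXnsubC.
rewrite lead1 scale1r in def.
have sep : separable_poly ('X^n - 1 : {poly C}).
  by apply: separable_Xn_sub_1; rewrite pnatr_eq0 -lt0n.
have rs_uniq : uniq rs by rewrite -separable_prod_XsubC -def.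
have rs_root : all n.-unity_root rs.
  by apply/allP=> z zrs; rewrite /root_of_unity def root_prod_XsubC.
have : has n.-primitive_root rs.
  apply: cyclic.has_prim_root => //.
  by rewrite -ltnS -(size_prod_XsubC rs id) -def size_XnsubC.
by move=> h; exists (nth 0 rs (find n.-primitive_root rs)); exact: nth_find.
Qed.

Lemma sum_prim_root n m (w : C) : n.-primitive_root w ->
  \sum_(j < n) (w ^+ j) ^+ m = if (n %| m)%N then n%:R else 0.
Proof.
move=> prim_w; under eq_bigr => j _ do rewrite exprAC.
rewrite (prim_order_dvd prim_w); case: eqP => [-> | /eqP wm1].
  by under eq_bigr => j _ do rewrite expr1n; rewrite sumr_const card_ord.
apply/eqP; rewrite -(mulrI_eq0 _ (@mulfI _ (w ^+ m - 1) _)) ?subr_eq0//.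
by rewrite -subrX1 exprAC (prim_expr_order prim_w) expr1n subrr.
Qed.

(** Cauchy's estimate by a finite average: over the [n]-th roots of unity with [n = size q], the
    mean of [t ^ (n - k) q(t)] is exactly the coefficient [k]. *)
Lemma coef_bound q B : 0 <= B -> (forall t, `|t| = 1 -> `|q.[t]| <= B) ->
  forall k, `|q`_k| <= B.
Proof.
move=> B0 qB k; have [kq|/(nth_default 0)->] := ltnP k (size q); last by rewrite normr0.
pose n := size q; have n_gt0 : (0 < n)%N by exact: leq_ltn_trans kq.
have [w prim_w] := exists_prim_root n_gt0.
have w1 : `|w| = 1.
  apply/eqP; rewrite -(@pexpr_eq1 _ _ n)// -normrX (prim_expr_order prim_w).
  by rewrite normr1.
have E : \sum_(j < n) (w ^+ j) ^+ (n - k) * q.[w ^+ j] = n%:R * q`_k.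
  under eq_bigr => j _ do rewrite horner_coef mulr_sumr.
  rewrite exchange_big /= (bigD1 (Ordinal kq))//= [X in _ + X]big1 ?addr0.
    under eq_bigr => j _ do rewrite mulrCA -exprD (subnK (ltnW kq)).
    by rewrite -mulr_sumr (sum_prim_root _ prim_w) dvdnn mulrC.
  move=> i /eqP ik; under eq_bigr => j _ do rewrite mulrCA -exprD.
  rewrite -mulr_sumr (sum_prim_root _ prim_w) ifN ?mulr0//.
  apply/negP => /dvdnP[c]; have /= := ltn_ord i; rewrite -/n => il E.
  apply: ik; apply/val_inj => /=.
  have : (c < 2)%N by rewrite -(ltn_pmul2r n_gt0) -E; lia.
  case: c E => [|[|//]] E _; first by move: kq; rewrite -/n; lia.
  by move: kq; rewrite -/n; lia.
rewrite -(@ler_pM2l _ n%:R) ?ltr0n// -{1}[n%:R]normr_nat -normrM -E.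
apply: le_trans (ler_norm_sum _ _ _) _.
rewrite mulr_natl -[in leRHS](card_ord n) -sumr_const; apply: ler_sum => j _.
have wj : `|w ^+ j| = 1 by rewrite normrX w1 expr1n.
by rewrite normrM normrX wj expr1n mul1r qB.
Qed.

Lemma horner_bound q B t : 0 <= B -> (forall k, `|q`_k| <= B) -> `|t| <= 2^-1 ->
  `|q.[t]| <= B *+ 2.
Proof.
move=> B0 + t2; elim/poly_ind: q => [|q c IH] qB.
  by rewrite horner0 normr0 mulrn_wge0.
rewrite hornerMXaddC mulr2n; apply: le_trans (ler_normD _ _) _.
apply: lerD; last by have := qB 0%N; rewrite coefD coefMX coefC /= add0r.
rewrite normrM; apply: le_trans (_ : (B *+ 2) * 2^-1 <= _).
  apply: ler_pM => //; apply: IH => k.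
  by have := qB k.+1; rewrite coefD coefMX coefC /= addr0.
by rewrite mulrnAl -mulrnAr -mulr_natr mulVf ?pnatr_eq0 ?mulr1.
Qed.

Lemma horner_remainder2 q B t : 0 <= B -> (forall k, `|q`_k| <= B) -> `|t| <= 2^-1 ->
  `|q.[t] - q`_0 - t * q`_1| <= B *+ 2 * `|t| ^+ 2.
Proof.
move=> B0 qB t2.
have -> : q = drop_poly 2 q * 'X^2 + take_poly 2 q by rewrite addrC poly_take_drop.
rewrite hornerD hornerM hornerXn !coefD !coefMXn /= !add0r !coef_take_poly /=.
have -> : (take_poly 2 q).[t] = q`_0 + t * q`_1.
  have := @horner_coef_wide _ 2 (take_poly 2 q) t (size_take_poly _ _).
  rewrite !big_ord_recl big_ord0 !coef_take_poly/= => ->.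
  by rewrite /bump /= expr0 expr1; ring.
rewrite [X in `|X|](_ : _ = (drop_poly 2 q).[t] * t ^+ 2); last by ring.
rewrite normrM normrX ler_wpM2r ?exprn_ge0//; apply: horner_bound => // k.
by rewrite coef_drop_poly.
Qed.

(** The bound stays uniform as [z2] approaches [z1]. For [|z2 - z1| >= r / 2] the difference
    quotient gives it directly; otherwise, after rescaling the disc to the unit disc, the
    coefficients of [g] are, up to a factor, those of [q] shifted by one, and Cauchy's estimate
    applies. *)
Lemma divided_difference_bound q g z1 z2 r B : 0 < r -> 0 <= B ->
  (forall z, `|z - z1| <= r -> `|q.[z]| <= B) -> `|q.[z2]| <= B ->
  q = (q.[z1])%:P + ('X - z1%:P) * g -> `|g.[z2]| <= B *+ 4 / r.
Proof.
move=> r0 B0 qB q2 E; have gE : g.[z2] * (z2 - z1) = q.[z2] - q.[z1].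
  by rewrite {1}E hornerD hornerC hornerM hornerXsubC mulrC addrAC subrr add0r.
have q1 : `|q.[z1]| <= B by apply: qB; rewrite subrr normr0 ltW.
have [far|near] := real_leP (gtr0_real (divr_gt0 r0 (ltr0Sn C 1))) (normr_real (z2 - z1)).
  rewrite ler_pdivlMr//.
  have : `|g.[z2]| * `|z2 - z1| <= B *+ 2.
    by rewrite -normrM gE mulr2n (le_trans (ler_normB _ _))// lerD.
  move/(le_trans (ler_wpM2l (normr_ge0 _) far)).
  by rewrite mulrA ler_pdivrMr ?ltr0n// mulr_natr -mulrnA.
pose q' := q \Po (r%:P * 'X + z1%:P); pose g' := g \Po (r%:P * 'X + z1%:P).
have qg k : q'`_k.+1 = r * g'`_k.
  rewrite /q' E comp_polyD comp_polyC comp_polyM comp_polyB comp_polyX comp_polyC.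
  by rewrite addrK mulrAC coefD coefC add0r coefMX/= coefCM.
have g'B k : `|g'`_k| <= B / r.
  rewrite ler_pdivlMr// -[r in X in X <= _](gtr0_norm r0) -normrM mulrC -qg.
  apply: coef_bound => // t t1; rewrite horner_comp !hornerE.
  by apply: qB; rewrite addrK normrM t1 mulr1 gtr0_norm.
have -> : g.[z2] = g'.[(z2 - z1) / r].
  by rewrite horner_comp hornerD hornerC hornerCM hornerX mulrC divfK ?subrK ?gt_eqF.
apply: le_trans (horner_bound _ g'B _) _.
- by rewrite divr_ge0// ltW.
- by rewrite normrM normfV (gtr0_norm r0) ler_pdivrMr// mulrC ltW.
- by rewrite -mulrnAl ler_pM2r ?invr_gt0// ler_wpMn2l.
Qed.

End ComplexPolynomials.

(** * Minimum modulus, open mapping and escape radius *)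

Section Escape.
Variable C : numClosedFieldType.
Implicit Types (q g G : {poly C}) (a z t w B r : C).

Lemma prod_prim_root n w z y : n.-primitive_root w ->
  `|\prod_(0 <= i < n) (z + y * w ^+ i)| = `|z ^+ n - (- y) ^+ n|.
Proof.
move=> prim_w; have n_gt0 := prim_order_gt0 prim_w.
have [->|y0] := eqVneq y 0.
  rewrite oppr0 expr0n gtn_eqF// subr0; congr (`|_|).
  by under eq_bigr do rewrite mul0r addr0; rewrite prodr_const_nat subn0.
have yN0 : - y != 0 by rewrite oppr_eq0.
have := congr1 (horner^~ (z / - y)) (factor_Xn_sub_1 prim_w).
rewrite horner_prod hornerD hornerN hornerXn hornerC => E.
have -> : z ^+ n - (- y) ^+ n = (- y) ^+ n * ((z / - y) ^+ n - 1).
  by rewrite mulrBr mulr1 -exprMn mulrC divfK.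
rewrite -E -{2}(subn0 n) -prodr_const_nat -big_split /=; congr (`|_|).
apply: eq_bigr => i _; rewrite hornerXsubC mulrBr [X in _ = X - _]mulrC divfK//.
by rewrite mulNr opprK.
Qed.

(* Otherwise every root lies at distance at least [r] from [a]; averaging
   [log |G|] over the points [a + r w ^+ j], [w] a primitive root of unity of
   large order, contradicts [`|G.[a]| < m]. *)
Lemma min_modulus G a r m : 0 < r -> 0 < m -> `|G.[a]| *+ 2 <= m ->
  (forall z, `|z - a| = r -> m <= `|G.[z]|) -> exists2 z, `|z - a| < r & root G z.
Proof.
move=> r0 m0 Gam mG; apply: contrapT => noroot.
have [rs Grs] := closed_field_poly_normal G.
have Gz z : `|G.[z]| = `|lead_coef G| * \prod_(x <- rs) `|z - x|.
  rewrite {1}Grs hornerZ horner_prod normrM normr_prod; congr (_ * _).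
  by apply: eq_bigr => x _; rewrite hornerXsubC.
have far x : x \in rs -> r <= `|a - x|.
  move=> xrs; rewrite real_leNgt ?normr_real ?gtr0_real//.
  apply/negP => ax; apply: noroot; exists x; first by rewrite distrC.
  have -> : root G x = root (\prod_(z <- rs) ('X - z%:P)) x.
    rewrite {1}Grs rootZ// lead_coef_eq0; apply/eqP => G0.
    have := mG (a + r); rewrite G0 horner0 normr0 addrAC subrr add0r gtr0_norm//.
    by move=> /(_ erefl)/(lt_le_trans m0); rewrite ltxx.
  by rewrite root_prod_XsubC.
(* One more than the number of roots: the factor [2 ^ size rs] lost below is strictly beaten by the
   [2 ^ n] gained from [2 |G(a)| <= m]. *)
pose n := (size rs).+1; have [w prim_w] := @exists_prim_root C n isT.
have w1 : `|w| = 1.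
  by apply/eqP; rewrite -(@pexpr_eq1 _ _ n)// -normrX (prim_expr_order prim_w) normr1.
have lower : m ^+ n <= \prod_(0 <= j < n) `|G.[a + r * w ^+ j]|.
  rewrite -[X in m ^+ X](subn0 n) -prodr_const_nat; apply: ler_prod => j _.
  rewrite ltW//= mG// addrAC subrr add0r normrM normrX w1 expr1n mulr1.
  exact: gtr0_norm.
have upper : \prod_(0 <= j < n) `|G.[a + r * w ^+ j]| <= `|G.[a]| ^+ n * 2 ^+ size rs.
  under eq_bigr do rewrite Gz.
  rewrite big_split /= prodr_const_nat subn0 exchange_big /=.
  rewrite Gz exprMn -mulrA ler_wpM2l ?exprn_ge0// -prodrXl.
  have -> : (2 : C) ^+ size rs = \prod_(x <- rs) 2.
    by rewrite big_const_seq count_predT iter_mulr mulr1.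
  rewrite -big_split /= big_seq [leRHS]big_seq; apply: ler_prod => x xrs.
  (* Each root [x] contributes [|(a - x) ^ n - (-r) ^ n| <= 2 |a - x| ^ n], since [r <= |a - x|]. *)
  rewrite prodr_ge0//=; under eq_bigr do rewrite addrAC.
  rewrite -normr_prod (prod_prim_root _ _ prim_w).
  rewrite (le_trans (ler_normB _ _))// !normrX normrN (gtr0_norm r0) mulr2n mulrDr mulr1.
  by rewrite lerD2l lerXn2r ?nnegrE ?far// ltW.
have : m ^+ n *+ 2 <= m ^+ n.
  apply: le_trans (_ : (`|G.[a]| *+ 2) ^+ n <= _); last first.
    by rewrite lerXn2r// nnegrE ?mulrn_wge0// ltW.
  rewrite exprMn_n expnSr mulrnA lerMn2r/= -mulr_natr natrX.
  exact: le_trans lower upper.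
by rewrite mulr2n gerDl; apply/negP; rewrite lt_geF// exprn_gt0.
Qed.

(** If every root of [q - w] were at distance at least [r] from [a], the factorisation would give
    [|q(a) - w| >= |lead_coef q| r ^ deg q]; this product is the witness [e]. *)
Lemma open_mapping q a r : (1 < size q)%N -> 0 < r ->
  exists2 e, 0 < e & forall w, `|w - q.[a]| < e -> exists2 z, `|z - a| < r & q.[z] = w.
Proof.
move=> q1 r0; have lc0 : lead_coef q != 0 by rewrite lead_coef_eq0 -size_poly_gt0 ltnW.
exists (`|lead_coef q| * r ^+ (size q).-1).
  by rewrite mulr_gt0 ?normr_gt0// exprn_gt0.
move=> w wq; apply: contrapT => nosol.
have szw : size (q - w%:P) = size q.
  by rewrite size_polyDl ?size_opp ?(leq_ltn_trans (size_polyC_leq1 _)).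
have lcw : lead_coef (q - w%:P) = lead_coef q.
  by rewrite lead_coefDl ?size_opp ?(leq_ltn_trans (size_polyC_leq1 _)).
have [rs] := closed_field_poly_normal (q - w%:P).
rewrite lcw => E.
have szrs : size rs = (size q).-1 by rewrite -szw E size_scale// size_prod_XsubC.
have := congr1 (fun p => `|p.[a]|) E.
rewrite hornerD hornerN hornerC distrC hornerZ normrM horner_prod normr_prod => Ea.
move: wq; rewrite Ea ltr_pM2l ?normr_gt0// -szrs.
have -> : r ^+ size rs = \prod_(x <- rs) r by rewrite big_const_seq count_predT iter_mulr mulr1.
apply/negP; rewrite -real_leNgt; last 2 first.
- by rewrite ger0_real// prodr_ge0// => *; rewrite ?normr_ge0// ltW.
- by rewrite ger0_real// prodr_ge0// => *; rewrite ?normr_ge0// ltW.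
rewrite big_seq [leRHS]big_seq; apply: ler_prod => x xrs; rewrite ltW//= hornerXsubC.
rewrite real_leNgt ?normr_real ?gtr0_real//; apply/negP => ax; apply: nosol.
exists x; first by rewrite distrC.
have : root (q - w%:P) x by rewrite E rootZ// root_prod_XsubC.
by rewrite rootE hornerD hornerN hornerC subr_eq0 => /eqP.
Qed.

Lemma poly_large q B : (1 < size q)%N -> 0 <= B ->
  exists2 r, 1 <= r & forall z, r <= `|z| -> B <= `|q.[z]|.
Proof.
elim/poly_ind: q B => [|q c IH] B; first by rewrite size_poly0.
have [->|q0] := eqVneq q 0; first by rewrite mul0r add0r size_polyC; case: (c != 0).
move=> _ B0; have Bc0 : 0 <= B + `|c| by rewrite addr_ge0.
suff [r r1 qr] : exists2 r, 1 <= r & forall z, r <= `|z| -> B + `|c| <= `|q.[z] * z|.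
  exists r => // z /qr; rewrite hornerMXaddC -lerBrDr => /le_trans; apply.
  by rewrite -[X in _ - X]normrN (le_trans (lerB_dist _ _))// opprK.
have [sq|] := ltnP 1 (size q).
  have [r r1 qr] := IH _ sq Bc0; exists r => // z rz.
  rewrite normrM -[leLHS]mulr1 ler_pM ?qr//; exact: le_trans rz.
move=> /size1_polyC qc; move: q0; rewrite qc polyC_eq0; set b := q`_0 => b0.
have nb : 0 < `|b| by rewrite normr_gt0.
exists (1 + (B + `|c|) / `|b|); first by rewrite lerDl divr_ge0.
move=> z bz; rewrite hornerC normrM mulrC -ler_pdivrMr//; apply: le_trans bz.
by rewrite lerDr.
Qed.

(** Split off the constant term, [q X + c] with [q] nonconstant: where [|q(z)| >= 2 + |c|] and
    [|z| >= 1], the value has modulus at least [(2 + |c|) |z| - |c| >= 2 |z|]. *)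
Lemma escape_radius q : (2 < size q)%N ->
  exists2 r, 1 <= r & forall z, r < `|z| -> `|z| *+ 2 <= `|q.[z]|.
Proof.
elim/poly_ind: q => [|q c _]; first by rewrite size_poly0.
rewrite size_MXaddC; case: ifP => // _; rewrite ltnS => sq.
have [r r1 qr] := @poly_large q (2 + `|c|) sq (addr_ge0 (ler0n _ 2) (normr_ge0 c)).
exists r => // z /ltW rz; have z1 := le_trans r1 rz.
rewrite hornerMXaddC (le_trans _ (lerB_normD _ _))// normrM lerBrDr.
apply: le_trans (ler_wpM2r (normr_ge0 z) (qr _ rz)).
by rewrite mulrDl mulr_natl lerD2l ler_peMr.
Qed.

End Escape.
(** * Escape and the filled Julia set *)

Section FilledJulia.
Variable C : numClosedFieldType.
Implicit Types (p q : {poly C}) (z r : C) (A : 'M[C]_2).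

Definition poly_iter p n : {poly C} := iter n (fun q => p \Po q) 'X.

Lemma poly_iterS p n : poly_iter p n.+1 = p \Po poly_iter p n. Proof. by []. Qed.

Lemma horner_poly_iter p n z : (poly_iter p n).[z] = iter n (horner p) z.
Proof. by elim: n => [|n IH]; rewrite ?hornerX// poly_iterS horner_comp IH. Qed.

Lemma horner_poly_iterD p m n z :
  (poly_iter p (m + n)).[z] = (poly_iter p m).[(poly_iter p n).[z]].
Proof. by rewrite !horner_poly_iter iterD. Qed.

Lemma horner_poly_iterSr p n z : (poly_iter p n.+1).[z] = (poly_iter p n).[p.[z]].
Proof. by rewrite !horner_poly_iter iterSr. Qed.

Lemma size_poly_iter p n : (2 < size p)%N -> (2 < size (poly_iter p n.+1))%N.
Proof.
move=> sp; elim: n => [|n IH]; first by rewrite /poly_iter/= comp_polyXr.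
have := size_comp_poly p (poly_iter p n.+1); rewrite -poly_iterS.
by move: sp IH; set a := size _; set b := size _; set c := size _; nia.
Qed.

Definition is_escape_radius p r :=
  1 <= r /\ forall z, r < `|z| -> `|z| *+ 2 <= `|p.[z]|.

(* The filled Julia set of [p] when [r] is an escape radius. *)
Definition filled p r z := forall n, `|(poly_iter p n).[z]| <= r.

Definition filled_interior p r z :=
  exists2 e, 0 < e & forall z', `|z' - z| < e -> filled p r z'.

Variables (p : {poly C}) (r : C).
Hypothesis escape_r : is_escape_radius p r.

Lemma escape_radius_gt0 : 0 < r.
Proof. by apply: lt_le_trans escape_r.1; exact: ltr01. Qed.
Let r0 := escape_radius_gt0.

(** Filledness of [p(z)] does not include the condition of index [0] at [z]; [|z| <= r] holds
    because outside this disc [p] at least doubles the modulus, leaving [p(z)] outside too. *)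
Lemma filled_horner z : filled p r p.[z] <-> filled p r z.
Proof.
split=> [Kpz [|n]|Kz n]; last by rewrite -horner_poly_iterSr.
  rewrite hornerX real_leNgt ?normr_real ?gtr0_real ?r0//; apply/negP => rz.
  have := Kpz 0%N; rewrite hornerX => /(le_trans (escape_r.2 _ rz)).
  by rewrite lt_geF// (lt_le_trans rz)// mulr2n lerDl.
by rewrite horner_poly_iterSr.
Qed.

Lemma filled_poly_iter n z : filled p r (poly_iter p n).[z] <-> filled p r z.
Proof.
by elim: n => [|n IH]; rewrite ?hornerX// poly_iterS horner_comp filled_horner.
Qed.

Lemma escape_growth z m : r < `|z| -> r *+ 2 ^ m < `|(poly_iter p m).[z]|.
Proof.
move=> rz; elim: m => [|m IH]; first by rewrite hornerX.
rewrite poly_iterS horner_comp expnSr mulrnA.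
apply: lt_le_trans (escape_r.2 _ _); first by rewrite ltrMn2r.
by apply: le_lt_trans IH; rewrite -[leLHS]mulr1n ler_wpMn2l ?expn_gt0// ltW// r0.
Qed.

Lemma filledPn z : ~ filled p r z -> exists n, r < `|(poly_iter p n).[z]|.
Proof.
move=> nK; apply: contrapT => H; apply: nK => n.
rewrite real_leNgt ?normr_real ?gtr0_real ?r0//; apply/negP => ?; apply: H.
by exists n.
Qed.

Lemma filled_interior_horner z :
  (1 < size p)%N -> filled_interior p r z -> filled_interior p r p.[z].
Proof.
move=> sp [e e0 Kz]; have [e' e'0 pz] := open_mapping z sp e0.
by exists e' => // w /pz[z' /Kz Kz' <-]; exact/filled_horner.
Qed.

End FilledJulia.

Lemma pos_lower_bound (K : numFieldType) (e1 e2 : K) :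
  0 < e1 -> 0 < e2 -> exists e, [/\ 0 < e, e <= e1 & e <= e2].
Proof.
move=> e10 e20; exists (e1^-1 + e2^-1)^-1.
have s0 : 0 < e1^-1 + e2^-1 by rewrite addr_gt0 ?invr_gt0.
split; first by rewrite invr_gt0.
  by rewrite -[leRHS]invrK lef_pV2 ?posrE ?invr_gt0// lerDl invr_ge0 ltW.
by rewrite -[leRHS]invrK lef_pV2 ?posrE ?invr_gt0// lerDr invr_ge0 ltW.
Qed.

(** * The entrywise sup norm *)

Section MatrixNorm.
Variable K : numFieldType.
Implicit Types (B : K).

Lemma le_mx_norm m n (M : 'M[K]_(m, n)) i j : `|M i j| <= `|M|.
Proof.
rewrite [leRHS]/Num.Def.normr /= mx_normE -[leLHS]nngE num_le.
exact: (le_bigmax _ (fun ij => `|M ij.1 ij.2|%:nng) (i, j)).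
Qed.

Lemma mx_norm_le m n (M : 'M[K]_(m, n)) B : 0 <= B ->
  (forall i j, `|M i j| <= B) -> `|M| <= B.
Proof.
move=> B0 MB; have [->//|/mx_norm_neq0[i Mi]] := eqVneq `|M| 0.
by rewrite [leLHS]/Num.Def.normr/= Mi.
Qed.

(** The entrywise sup norm is not submultiplicative; the inner dimension gives the factor [2], which
    recurs in the eigenvalue bounds below. *)
Lemma mulmx_norm_le m n (M : 'M[K]_(m, 2)) (N : 'M[K]_(2, n)) :
  `|M *m N| <= `|M| * `|N| *+ 2.
Proof.
apply: mx_norm_le => [|i j]; first by rewrite mulrn_wge0// mulr_ge0.
rewrite mxE big_ord_recl big_ord1 mulr2n (le_trans (ler_normD _ _))//.
by rewrite !normrM lerD// ler_pM// le_mx_norm.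
Qed.

End MatrixNorm.

(** * Polynomial calculus of 2 by 2 matrices *)

Section Matrices2.
Variable C : numClosedFieldType.
Implicit Types (q g : {poly C}) (a z : C) (A : 'M[C]_2).

Lemma eigenvalue_norm_le A a : eigenvalue A a -> `|a| <= `|A| *+ 2.
Proof.
case/eigenvalueP => v vA v0; have v0' : 0 < `|v| by rewrite normr_gt0.
rewrite -(ler_pM2r v0') -normrZ -vA (le_trans (mulmx_norm_le _ _))//.
by rewrite mulrnAl mulrC.
Qed.

Lemma horner_mx_comp_poly A p q : horner_mx A (p \Po q) = horner_mx (horner_mx A q) p.
Proof.
elim/poly_ind: p => [|p c IH]; first by rewrite comp_poly0 !rmorph0.
rewrite comp_polyD comp_polyM comp_polyX comp_polyC !rmorphD !rmorphM /=.
by rewrite IH !horner_mx_C horner_mx_X.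
Qed.

Lemma iter_matrix_poly p n A : iter n (matrix_poly p) A = matrix_poly (poly_iter p n) A.
Proof.
elim: n => [|n IH]; rewrite /matrix_poly; first by rewrite horner_mx_X.
by rewrite iterS IH poly_iterS horner_mx_comp_poly.
Qed.

Lemma horner_row_eigen A q a (v : 'rV[C]_2) :
  v *m A = a *: v -> v *m horner_mx A q = q.[a] *: v.
Proof.
move=> vA; elim/poly_ind: q => [|q c IH].
  by rewrite rmorph0 mulmx0 horner0 scale0r.
rewrite rmorphD rmorphM /= horner_mx_C horner_mx_X mulmxDr mulmxA IH -scalemxAl vA.
by rewrite hornerMXaddC scalerDl scalerA mul_mx_scalar.
Qed.

Lemma eigenvalue_horner A q a : eigenvalue A a -> eigenvalue (horner_mx A q) q.[a].
Proof.
by case/eigenvalueP => v vA v0; apply/eigenvalueP; exists v => //; exact: horner_row_eigen.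
Qed.

Lemma char_poly2 A : exists z1 z2, char_poly A = ('X - z1%:P) * ('X - z2%:P).
Proof.
have [rs] := closed_field_poly_normal (char_poly A).
rewrite (eqP (char_poly_monic A)) scale1r => E.
have := size_char_poly A; rewrite E size_prod_XsubC => -[].
case: rs E => [|z1 [|z2 []]]// _ _; exists z1, z2.
by rewrite !big_cons big_nil mulr1.
Qed.

Lemma root_XsubCM z1 z2 z : root (('X - z1%:P) * ('X - z2%:P)) z = (z == z1) || (z == z2).
Proof. by rewrite rootM !root_XsubC. Qed.

(** Newton interpolation: replacing [g] by [g(z2)] changes [q] by a multiple of [(X - z1)(X - z2)],
    which [A] annihilates. Assuming only annihilation lets the formula be used on explicitly built
    matrices without computing their characteristic polynomial. *)
Lemma horner_mx_2roots A q g z1 z2 : horner_mx A (('X - z1%:P) * ('X - z2%:P)) = 0 ->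
  q = (q.[z1])%:P + ('X - z1%:P) * g ->
  horner_mx A q = (q.[z1])%:M + g.[z2] *: (A - z1%:M).
Proof.
move=> A0 {1}->; rewrite rmorphD /= horner_mx_C; congr (_ + _).
have /factor_theorem[h hE] : root (g - (g.[z2])%:P) z2.
  by rewrite rootE hornerD hornerN hornerC subrr.
rewrite -[g in LHS](subrK (g.[z2])%:P) hE mulrDr rmorphD /= mulrCA rmorphM/= A0 mulr0 add0r.
rewrite rmorphM /= rmorphB/= horner_mx_C horner_mx_X horner_mx_C.
exact: mul_mx_scalar.
Qed.

Lemma horner_split q a : exists g, q = (q.[a])%:P + ('X - a%:P) * g.
Proof.
have /factor_theorem[h hE] : root (q - (q.[a])%:P) a.
  by rewrite rootE hornerD hornerN hornerC subrr.
by exists h; rewrite mulrC -hE addrC subrK.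
Qed.

End Matrices2.
(** * Matrix polynomials as differentiable maps *)

Section MatrixNbhs.
Variables (K : numFieldType) (m n : nat).

Lemma nbhs_mxP (M : 'M[K]_(m, n)) (P : set 'M[K]_(m, n)) :
  nbhs M P <-> exists2 e, 0 < e & forall N, `|N - M| < e -> P N.
Proof.
rewrite -filter_from_norm_nbhs; split=> -[e e0 eP]; exists e => // N.
  by rewrite distrC => /eP.
by move=> /= MN; apply: eP; rewrite distrC.
Qed.

Lemma cvg_mxP T (F : set_system T) {FF : Filter F} (f : T -> 'M[K]_(m, n))
    (l : 'M[K]_(m, n)) :
  f @ F --> l <-> forall e, 0 < e -> \forall t \near F, `|f t - l| <= e.
Proof.
split=> [fl e e0|H].
  have : nbhs l [set N | `|N - l| <= e] by apply/nbhs_mxP; exists e => // N /ltW.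
  exact: fl.
move=> P /nbhs_mxP[e e0 eP]; have e20 : 0 < e / 2 by rewrite divr_gt0.
apply: filterS (H _ e20) => t ft; apply: eP; apply: le_lt_trans ft _.
by rewrite ltr_pdivrMr// mulr_natr mulr2n ltrDl.
Qed.

End MatrixNbhs.

Lemma differentiable_of_remainder (K : numFieldType) (V W : normedModType K)
    (f D : V -> W) (x : V) (k c e : K) :
  linear D -> 0 <= k -> 0 <= c -> 0 < e -> (forall h, `|D h| <= k * `|h|) ->
  (forall h, `|h| <= e -> `|f (x + h) - f x - D h| <= c * `|h| ^+ 2) ->
  differentiable f x.
Proof.
move=> linD k0 c0 e0 Dk fD.
pose DL : {linear V -> W} := HB.pack D (GRing.isLinear.Build _ _ _ _ D linD).
have contD : continuous DL.
  move=> a; apply/cvgrPdist_le => eps eps0; apply/nbhs_normP.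
  exists (eps / (k + 1)) => [|b /= ab]; first by rewrite /= divr_gt0// ltr_wpDl.
  rewrite -(linearB DL) (le_trans (Dk _))//.
  rewrite (le_trans _ (_ : (k + 1) * `|a - b| <= _))//; first by rewrite ler_wpM2r// lerDl.
  by rewrite mulrC -ler_pdivlMr ?ltr_wpDl// ltW.
have expand : f \o shift x = cst (f x) + DL +o_ 0 id.
  apply/eqaddoP => eps eps0; apply/nbhs_normP.
  (* The inverse of this sum is the radius: it is at most [e] and makes [c |h| <= eps], without
     dividing by [c], which may be [0]. *)
  have ce : 0 < eps^-1 * c + e^-1 by rewrite ltr_wpDl ?invr_gt0// mulr_ge0// invr_ge0 ltW.
  exists (eps^-1 * c + e^-1)^-1 => [|h /=]; first by rewrite /= invr_gt0.
  rewrite sub0r normrN => hlt; rewrite [X in `|X|](_ : _ = f (x + h) - f x - D h); last first.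
    by rewrite [x + h]addrC -addrA -opprD.
  have h1 : `|h| * (eps^-1 * c + e^-1) <= 1 by rewrite -ler_pdivlMr// div1r ltW.
  apply: le_trans (fD _ _) _.
    rewrite -[leRHS]mul1r -ler_pdivrMr//; apply: le_trans h1.
    by rewrite mulrDr lerDr !mulr_ge0// invr_ge0 ltW.
  rewrite expr2 mulrA ler_wpM2r//= -[leRHS]mulr1 -ler_pdivrMl//; apply: le_trans h1.
  by rewrite mulrA [leLHS]mulrC mulrDr lerDl mulr_ge0// invr_ge0 ltW.
by apply/diff_locallyP; rewrite (diff_unique contD expand).
Qed.

Section MatrixPolyDiff.
Variable K : numFieldType.
Implicit Types (q : {poly K}) (e k c : K) (A x h : 'M[K]_2).

Lemma matrix_poly_remainder q x : exists D : 'M[K]_2 -> 'M[K]_2,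
  linear D /\ exists2 k, 0 <= k & (forall h, `|D h| <= k * `|h|) /\
  forall h, `|h| <= 1 ->
    `|matrix_poly q (x + h) - matrix_poly q x - D h| <= k * `|h| ^+ 2.
Proof.
rewrite /matrix_poly; elim/poly_ind: q => [|q c [D [linD [k k0 [Dk rem]]]]].
  exists (fun=> 0); split; first by move=> a u v; rewrite scaler0 addr0.
  exists 0; first by [].
  by split=> [h|h _]; rewrite ?rmorph0 ?subr0 normr0 mul0r.
(* The product rule for [q(x) x], with the factors kept in order because [h] and [x] need not
   commute. *)
exists (fun h => D h *m x + horner_mx x q *m h); split.
  by move=> a u v; rewrite linD mulmxDl mulmxDr -!scalemxAl -!scalemxAr scalerDr addrACA.
set a := `|horner_mx x q|; pose k' := k * (`|x| + 1) *+ 2 + (k + a) *+ 2.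
have x0 : 0 <= `|x| := normr_ge0 x; have a0 : 0 <= a := normr_ge0 _.
exists k'; first by rewrite addr_ge0// mulrn_wge0// ?mulr_ge0 ?addr_ge0.
split=> h.
  apply: le_trans (ler_normD _ _) _.
  apply: le_trans (lerD (mulmx_norm_le _ _) (mulmx_norm_le _ _)) _.
  rewrite -mulrnDl -/a; apply: le_trans (_ : (k * `|h| * `|x| + a * `|h|) *+ 2 <= _).
    by rewrite lerMn2r/= lerD2r ler_wpM2r.
  rewrite -subr_ge0 /k' (_ : _ - _ = (k * `|h|) *+ 4); last by ring.
  by rewrite mulrn_wge0// mulr_ge0.
move=> h1.
set rm := horner_mx (x + h) q - horner_mx x q - D h.
have -> : horner_mx (x + h) (q * 'X + c%:P) - horner_mx x (q * 'X + c%:P) -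
    (D h *m x + horner_mx x q *m h) = rm *m (x + h) + D h *m h.
  rewrite !rmorphD !rmorphM /= !horner_mx_C !horner_mx_X /rm -!mulmxE.
  rewrite !mulmxBl !mulmxDr; apply/matrixP => i j; rewrite !mxE; ring.
apply: le_trans (ler_normD _ _) _; apply: le_trans (lerD (mulmx_norm_le _ _) (mulmx_norm_le _ _)) _.
have xh : `|x + h| <= `|x| + 1 by rewrite (le_trans (ler_normD _ _))// lerD2l.
have step1 : `|rm| * `|x + h| <= k * `|h| ^+ 2 * (`|x| + 1) by rewrite ler_pM// rem.
have step2 : `|D h| * `|h| <= k * `|h| * `|h| by rewrite ler_wpM2r.
rewrite -mulrnDl; apply: le_trans (_ : (k * `|h| ^+ 2 * (`|x| + 1) + k * `|h| * `|h|) *+ 2 <= _).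
  by rewrite lerMn2r/= lerD.
rewrite -subr_ge0 /k' (_ : _ - _ = (a * `|h| ^+ 2) *+ 2); last by ring.
by rewrite mulrn_wge0// mulr_ge0// exprn_ge0.
Qed.

Lemma differentiable_matrix_poly q x : differentiable (matrix_poly q) x.
Proof.
have [D [linD [k k0 [Dk rem]]]] := matrix_poly_remainder q x.
exact: (differentiable_of_remainder linD k0 k0 ltr01 Dk rem).
Qed.

Lemma continuous_matrix_poly q : continuous (matrix_poly q : 'M[K]_2 -> 'M[K]_2).
Proof. by move=> x; exact: differentiable_continuous (differentiable_matrix_poly q x). Qed.

End MatrixPolyDiff.

(** * Cauchy estimates for matrix polynomials *)

Section CauchyEstimates.
Variable C : numClosedFieldType.
Implicit Types (q : {poly C}) (B e k c rho : C) (A x h : 'M[C]_2).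

Lemma matrix_poly_line q x h : exists Q : 'I_2 -> 'I_2 -> {poly C},
  forall t i j, matrix_poly q (x + t *: h) i j = (Q i j).[t].
Proof.
rewrite /matrix_poly; elim/poly_ind: q => [|q c [Q QE]].
  by exists (fun _ _ => 0) => t i j; rewrite rmorph0 mxE horner0.
exists (fun i j => \sum_k Q i k * ((x k j)%:P + (h k j)%:P * 'X) + (c *+ (i == j))%:P).
move=> t i j; rewrite rmorphD rmorphM /= horner_mx_C horner_mx_X -mulmxE !mxE.
rewrite hornerD hornerC horner_sum; congr (_ + _); apply: eq_bigr => k _.
by rewrite hornerM QE !mxE hornerD hornerM hornerX !hornerC mulrC [t * _]mulrC mulrC.
Qed.

(* The Cauchy estimates are applied to the one-variable polynomials
   [t |-> P (x + t h)], [|h| = rho]. *)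
Lemma cauchy_estimates q x rho B : 0 < rho -> 0 <= B ->
  (forall y, `|y - x| <= rho -> `|matrix_poly q y| <= B) ->
  exists D : 'M[C]_2 -> 'M[C]_2, [/\ linear D,
    forall h, `|D h| <= B / rho * `|h| &
    forall h, `|h| <= rho / 2 ->
      `|matrix_poly q (x + h) - matrix_poly q x - D h| <= (B *+ 2 / rho ^+ 2) * `|h| ^+ 2].
Proof.
move=> rho0 B0 qB.
have [D [linD [k k0 [Dk rem]]]] := matrix_poly_remainder q x.
pose DL : {linear 'M[C]_2 -> 'M[C]_2} := HB.pack D (GRing.isLinear.Build _ _ _ _ D linD).
have D0 : D 0 = 0 := linear0 DL.
have DZ a u : D (a *: u) = a *: D u by rewrite -[a *: u]addr0 linD D0 addr0.
(* By homogeneity it suffices to treat directions of norm exactly [rho]; a nonzero [h] is rescaled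
   to [(rho / |h|) h]. *)
suff key h : `|h| = rho -> `|D h| <= B /\
    forall t, `|t| <= 2^-1 ->
      `|matrix_poly q (x + t *: h) - matrix_poly q x - t *: D h| <= B *+ 2 * `|t| ^+ 2.
  exists D; split=> // h.
    have [->|h0] := eqVneq h 0; first by rewrite D0 !normr0 mulr0.
    have nh0 : 0 < `|h| by rewrite normr_gt0.
    have [|+ _] := key ((rho / `|h|) *: h).
      by rewrite normrZ ger0_norm ?divr_ge0 ?(ltW rho0)// divfK ?gt_eqF.
    rewrite DZ normrZ ger0_norm ?divr_ge0 ?(ltW rho0)// => H.
    by rewrite mulrAC ler_pdivlMr// mulrC -ler_pdivrMr// mulrAC.
  move=> hrho.
  have [->|h0] := eqVneq h 0.
    by rewrite D0 addr0 subrr subr0 !normr0 expr0n mulr0.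
  have nh0 : 0 < `|h| by rewrite normr_gt0.
  have [|_ /(_ (`|h| / rho))] := key ((rho / `|h|) *: h).
    by rewrite normrZ ger0_norm ?divr_ge0 ?(ltW rho0)// divfK ?gt_eqF.
  rewrite DZ !scalerA mulrA divfK ?gt_eqF// divff ?gt_eqF// !scale1r.
  rewrite ger0_norm ?divr_ge0 ?(ltW rho0)// ler_pdivrMr// mulrC => /(_ hrho).
  by rewrite expr_div_n [X in _ <= X -> _]mulrA [X in _ -> _ <= X]mulrAC.
move=> hrho; have [Q QE] := matrix_poly_line q x h.
have QB i j l : `|(Q i j)`_l| <= B.
  apply: coef_bound => // t t1; rewrite -QE (le_trans (le_mx_norm _ _ _))// qB//.
  by rewrite addrAC subrr add0r normrZ t1 mul1r hrho.
have Q0 i j : (Q i j)`_0 = matrix_poly q x i j.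
  by rewrite -horner_coef0 -QE scale0r addr0.
suff Q1 i j : D h i j = (Q i j)`_1.
  split; first by apply: mx_norm_le => // i j; rewrite Q1.
  move=> t t2; apply: mx_norm_le => [|i j].
    by rewrite mulr_ge0 ?mulrn_wge0 ?exprn_ge0.
  rewrite mxE [in X in _ + X]mxE mxE [in X in _ + X - _]mxE [X in _ - X]mxE QE Q1 -Q0.
  exact: horner_remainder2.
(* Both numbers are first-order coefficients at [t = 0] of the same function, so they differ by at
   most [K t] for small [t]. The choice of [s] makes [t = 1 / s] satisfy [K t <= e], [t rho <= 1]
   and [t <= 1 / 2]. *)
apply/eqP; rewrite -subr_eq0 -normr_le0; apply/ler_addgt0Pr => e e0; rewrite add0r.
pose K := k * rho ^+ 2 + B *+ 2.
have K0 : 0 <= K by rewrite addr_ge0 ?mulr_ge0 ?exprn_ge0 ?mulrn_wge0// ltW.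
pose s := e^-1 * K + rho + 2.
have s0 : 0 < s by rewrite !ltr_wpDl// ?addr_ge0 ?mulr_ge0 ?invr_ge0// ltW.
pose t := s^-1; have t0 : 0 < t by rewrite invr_gt0.
have ts : t * s = 1 by rewrite mulVf ?gt_eqF.
have tK : K * t <= e.
  rewrite mulrC -[leRHS]mul1r -ts -mulrA ler_wpM2l ?(ltW t0)//.
  by rewrite -ler_pdivrMr// mulrC /s -addrA lerDl addr_ge0// ltW.
have trho : t * rho <= 1.
  rewrite -ler_pdivlMr// div1r lef_pV2 ?posrE//.
  by rewrite /s -addrA addrCA lerDl addr_ge0// mulr_ge0// invr_ge0 ltW.
have t2 : `|t| <= 2^-1.
  rewrite gtr0_norm// lef_pV2 ?posrE//.
  by rewrite /s lerDr addr_ge0 ?mulr_ge0 ?invr_ge0// ltW.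
have r1 := horner_remainder2 B0 (QB i j) t2.
have : `|t *: h| = t * rho by rewrite normrZ hrho gtr0_norm.
move=> nth; have := rem (t *: h); rewrite nth => /(_ trho)/(le_trans (le_mx_norm _ i j)).
rewrite DZ mxE [in X in _ + X]mxE mxE [in X in _ + X - _]mxE [X in _ - X]mxE QE -Q0 => r2.
apply: le_trans tK; rewrite -(ler_pM2r t0) -mulrA -expr2.
have -> : `|D h i j - (Q i j)`_1| * t = `|t * D h i j - t * (Q i j)`_1|.
  by rewrite -mulrBr normrM gtr0_norm// mulrC.
rewrite (_ : t * _ - _ = ((Q i j).[t] - (Q i j)`_0 - t * (Q i j)`_1) -
  ((Q i j).[t] - (Q i j)`_0 - t * D h i j)); last by ring.
apply: le_trans (ler_normB _ _) _; apply: le_trans (lerD r1 r2) _.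
by rewrite (gtr0_norm t0) exprMn addrC [t ^+ 2 * _]mulrC mulrA -mulrDl.
Qed.

End CauchyEstimates.
(** * Limits along ultrafilters and normality *)

Section UltrafilterLimits.

(** An ultrafilter converges to each of its cluster points: if the preimage of a neighbourhood were
    missing, its complement would belong to the ultrafilter. *)
Lemma ultra_cvg_compact (T : Type) (X : topologicalType) (U : set_system T)
    (u : T -> X) (A : set X) :
  UltraFilter U -> compact A -> U (u @^-1` A) -> exists2 l, A l & u @ U --> l.
Proof.
move=> UU cA UA; have [l [Al cl]] := cA (u @ U) _ UA.
exists l => // V lV; have [//|UnV] := in_ultra_setVsetC (u @^-1` V) UU.
by have [x [nVx Vx]] := cl (~` V) V UnV lV.
Qed.

Variable R : realType.
(* The library declares a topology on the sorts of the numeric structures, not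
   on the type [R[i]] itself. *)
Local Notation C := [the numClosedFieldType of R[i]].
Implicit Types (M : 'M[C]_2).

Lemma normc_ge_Im (z : C) : (`|complex.Im z|)%:C <= `|z|.
Proof.
case: z => a b; rewrite normc_def /= lecR -sqrtr_sqr ler_wsqrtr//.
by rewrite lerDr sqr_ge0.
Qed.

Lemma normc_le_ReIm (z : C) : `|z| <= (`|complex.Re z| + `|complex.Im z|)%:C.
Proof.
case: z => a b; rewrite normc_def /= lecR.
rewrite -[leRHS]ger0_norm ?addr_ge0// -sqrtr_sqr ler_wsqrtr//.
by rewrite sqrrD !real_normK ?num_real// addrAC lerDl mulrn_wge0// mulr_ge0.
Qed.

Lemma ultra_cvg_bounded (T : Type) (U : set_system T) (u : T -> R) (b : R) :
  UltraFilter U -> U [set t | `|u t| <= b] -> exists l : R, u @ U --> l.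
Proof.
move=> UU Ub; have Ub' : U (u @^-1` `[- b, b]).
  by apply: filterS Ub => t /=; rewrite in_itv/= -ler_norml.
by have [l _ ul] := ultra_cvg_compact UU (@segment_compact R (- b) b) Ub'; exists l.
Qed.

(** Real and imaginary parts of each entry lie in a compact segment; the finitely many entries are
    then recombined, a filter being closed under finite intersections. *)
Lemma ultra_cvg_mx (T : Type) (U : set_system T) (u : T -> 'M[C]_2) (B : C) :
  UltraFilter U -> U [set t | `|u t| <= B] -> exists l : 'M[C]_2, u @ U --> l.
Proof.
move=> UU UB; have PU : ProperFilter U by exact: ultra_proper.
have [t0 /= B0] := filter_ex UB; have Bre : B = (complex.Re B)%:C.
  by rewrite RRe_real// ger0_real// (le_trans _ B0).
have cvg_coord (g : C -> R) : (forall z, `|g z|%:C <= `|z|) ->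
    exists a : 'I_2 -> 'I_2 -> R, forall i j, (fun t => g (u t i j)) @ U --> a i j.
  move=> gz; have ex i j : exists l : R, (fun t => g (u t i j)) @ U --> l.
    apply: (@ultra_cvg_bounded _ U _ (complex.Re B)); apply: filterS UB => t /= utB.
    by rewrite -lecR -Bre (le_trans (gz _))// (le_trans (le_mx_norm _ _ _)).
  exists (fun i j => sval (cid (ex i j))) => i j; exact: (svalP (cid (ex i j))).
have [a aP] := cvg_coord _ (@normc_ge_Re R).
have [b bP] := cvg_coord _ normc_ge_Im.
exists (\matrix_(i, j) (a i j +i* b i j)); apply/cvg_mxP => e e0.
have eE : e = (complex.Re e)%:C by rewrite RRe_real// gtr0_real.
have e'0 : 0 < complex.Re e / 2 by rewrite divr_gt0// -ltcR -eE.
have near_ij i j : \forall t \near U, `|u t i j - (a i j +i* b i j)| <= e.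
  have := aP i j; move/cvgrPdist_le => /(_ _ e'0) Ha.
  have := bP i j; move/cvgrPdist_le => /(_ _ e'0) Hb.
  apply: filterS2 Ha Hb => t /= ta tb; apply: le_trans (normc_le_ReIm _) _.
  rewrite eE lecR [leRHS]splitr lerD//.
    by apply: le_trans ta; rewrite distrC; case: (u t i j).
  by apply: le_trans tb; rewrite distrC; case: (u t i j).
have : \forall t \near U, forall ij : 'I_2 * 'I_2,
    `|u t ij.1 ij.2 - (a ij.1 ij.2 +i* b ij.1 ij.2)| <= e.
  by apply: filter_forall => -[i j]; exact: near_ij.
apply: filterS => t ut; apply: mx_norm_le => [|i j]; first exact: ltW.
by rewrite !mxE; exact: (ut (i, j)).
Qed.

Lemma cvg_mx_norm_le (T : Type) (U : set_system T) (u : T -> 'M[C]_2)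
    (l N : 'M[C]_2) (B : C) :
  ProperFilter U -> u @ U --> l -> U [set t | `|u t - N| <= B] -> `|l - N| <= B.
Proof.
move=> PU /cvg_mxP ul UB; apply/ler_addgt0Pr => e e0.
have [t [/= tB tl]] := filter_ex (filterI UB (ul e e0)).
have -> : l - N = (l - u t) + (u t - N) by rewrite subrKA.
by rewrite addrC (le_trans (ler_normD _ _))// lerD// distrC.
Qed.

Lemma compact_mx_ball (N : 'M[C]_2) (B : C) : compact [set M : 'M[C]_2 | `|M - N| <= B].
Proof.
rewrite compact_ultra => F FU FB; have PF : ProperFilter F by exact: ultra_proper.
have [|l Fl] := @ultra_cvg_mx _ F id (B + `|N|) FU.
  apply: filterS FB => M /= MB.
  by rewrite -[M](subrK N) (le_trans (ler_normD _ _))// lerD2r.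
by exists l; split; [exact: cvg_mx_norm_le Fl FB | exact: Fl].
Qed.

Lemma natr_gt_complex (x : C) : x \is Num.real -> exists n, x < n%:R.
Proof.
move=> /RRe_real <-; exists (Num.bound `|complex.Re x|).
rewrite -(rmorph_nat (real_complex R)) ltcR.
by rewrite (le_lt_trans (ler_norm _))// archi_boundP.
Qed.

End UltrafilterLimits.
Lemma entourage_norm (K : numFieldType) (V : pseudoMetricNormedZmodType K) (E : set (V * V)) :
  entourage E -> exists2 e, 0 < e & forall x y : V, `|x - y| < e -> E (x, y).
Proof.
rewrite -entourage_ballE => -[e /= e0 eE]; exists e => // x y xy; apply: eE.
by rewrite /= -ball_normE.
Qed.

Lemma increasing_extraction (P : nat -> nat -> Prop) :
  (forall j m, exists n, (m < n)%N /\ P j n) ->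
  exists2 phi : nat -> nat, {homo phi : i j / (i < j)%N} & forall j, P j (phi j).
Proof.
move=> Pjm; have {Pjm} /choice[g gP] jm : exists n, (jm.2 < n)%N /\ P jm.1 n by exact: Pjm.
pose phi := fix F j := if j is j'.+1 then g (j, F j') else g (0%N, 0%N).
exists phi; last by case=> [|j]; exact: (gP (_, _)).2.
by apply: homo_ltn => [|j]; [exact: ltn_trans | exact: (gP (_, _)).1].
Qed.

Section MatrixLimits.
Variables (K : numFieldType) (T : Type) (F : set_system T).
Hypothesis FF : ProperFilter F.
Implicit Types (f g : T -> 'M[K]_2) (a b : 'M[K]_2).

Lemma cvg_mx_unique f a b : f @ F --> a -> f @ F --> b -> a = b.
Proof. by move=> fa fb; exact: (cvg_unique (@norm_hausdorff K 'M[K]_2) fa fb). Qed.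

Lemma cvg_mxZD k f g a b :
  f @ F --> a -> g @ F --> b -> (fun t => k *: f t + g t) @ F --> k *: a + b.
Proof.
move=> fa gb.
exact: (@cvgD K 'M[K]_2 T F _ (fun t => k *: f t) g _ _ (@cvgZl_tmp K 'M[K]_2 T F _ k f a fa) gb).
Qed.

Lemma cvg_mxB f g a b :
  f @ F --> a -> g @ F --> b -> (fun t => f t - g t) @ F --> a - b.
Proof.
move=> fa gb; exact: (@cvgB K 'M[K]_2 T F _ f g _ _ fa gb).
Qed.

End MatrixLimits.

(** * Montel's theorem for matrix polynomials *)

Section Montel.
Variable R : realType.
Local Notation C := [the numClosedFieldType of R[i]].
Implicit Types (rho B e : C) (x h M N : 'M[C]_2).

(* A pointwise limit along an ultrafilter exists by boundedness; the uniform
   Lipschitz and second-order bounds make it differentiable and make the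
   convergence uniform on a compact ball, whence a subsequence. *)
Lemma montel_matrix_poly (q : nat -> {poly C}) N rho B : 0 < rho ->
  (forall n M, `|M - N| <= rho *+ 2 -> `|matrix_poly (q n) M| <= B) ->
  exists2 phi, {homo phi : i j / (i < j)%N} &
    exists f, holomorphic_on [set M : 'M[C]_2 | `|M - N| < rho] f /\
      {family compactly_in [set M : 'M[C]_2 | `|M - N| < rho],
        (fun k => matrix_poly (q (phi k))) @ \oo --> f}.
Proof.
move=> rho0 qB; pose ball2 M := `|M - N| <= rho *+ 2.
have B0 : 0 <= B.
  by apply: le_trans (qB 0%N N _) => //; rewrite /ball2 subrr normr0 mulrn_wge0// ltW.
(* An ultrafilter refining convergence to infinity: pointwise limits exist along it at all points of
   [ball2] at once, with no diagonal extraction. *)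
have [U [UU Uoo]] := @ultraFilterLemma nat \oo _.
have PU : ProperFilter U by exact: ultra_proper.
pose F n M : 'M[C]_2 := matrix_poly (q n) M.
have /choice[f fP] M : exists l : 'M[C]_2, ball2 M -> (fun n => F n M) @ U --> l.
  have [Mb|nMb] := pselect (ball2 M); last by exists 0.
  have [|l ul] := @ultra_cvg_mx R nat U (fun n => F n M) B UU; last by exists l.
  by apply: filterE => n /=; exact: qB.
pose A : set 'M[C]_2 := [set M | `|M - N| <= rho].
have A_ball2 x h : A x -> `|h| <= rho -> ball2 (x + h).
  move=> Ax h1; rewrite /ball2 addrAC (le_trans (ler_normD _ _))// mulr2n lerD//.
have cauchy x n := @cauchy_estimates C (q n) x rho B rho0 B0.
(* One [B / rho] comes from the differential, the other from the remainder [(2 B / rho ^ 2) |h| ^ 2]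
   when [|h| <= rho / 2]. *)
pose L := B / rho *+ 2.
have L0 : 0 <= L by rewrite mulrn_wge0// divr_ge0// ltW.
have estimate x n : A x -> exists D : 'M[C]_2 -> 'M[C]_2, [/\ linear D,
    forall h, `|D h| <= B / rho * `|h| &
    forall h, `|h| <= rho / 2 ->
      `|F n (x + h) - F n x - D h| <= (B *+ 2 / rho ^+ 2) * `|h| ^+ 2].
  move=> Ax; apply: cauchy => y yx; apply: qB.
  by have := A_ball2 x (y - x) Ax yx; rewrite addrCA subrr addr0.
have rho2 : rho / 2 <= rho by rewrite ler_pdivrMr// ler_peMr ?ler1n// ltW.
have A_ball2' x : A x -> ball2 x.
  by move=> Ax; rewrite -[x]addr0; apply: A_ball2 => //; rewrite normr0 ltW.
have lipF x h n : A x -> `|h| <= rho / 2 -> `|F n (x + h) - F n x| <= L * `|h|.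
  move=> Ax hrho; have [D [_ Dh rem]] := estimate x n Ax.
  rewrite -[X in `|X|](subrK (D h)) (le_trans (ler_normD _ _))//.
  rewrite /L mulrnAl mulr2n lerD// (le_trans (rem _ hrho))//.
  rewrite [`|h| ^+ 2]expr2 mulrA ler_wpM2r// (le_trans (ler_wpM2l _ hrho))//.
    by rewrite divr_ge0 ?mulrn_wge0 ?exprn_ge0// ltW.
  rewrite le_eqVlt; apply/orP; left; apply/eqP; rewrite -mulr_natr.
  by field; rewrite gt_eqF.
have lipf x h : A x -> `|h| <= rho / 2 -> `|f (x + h) - f x| <= L * `|h|.
  move=> Ax hrho; rewrite -[X in `|X|]subr0.
  apply: (@cvg_mx_norm_le R nat U (fun n => F n (x + h) - F n x)) => //.
    apply: cvg_mxB; apply: fP; [apply: A_ball2 => //; exact: le_trans hrho rho2 | exact: A_ball2'].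
  by apply: filterE => n /=; rewrite subr0; exact: lipF.
have diff_f x : A x -> differentiable f x.
  move=> Ax; have /choice[D DP] n := estimate x n Ax.
  (* The differentials [D n] converge along [U] as well; linearity and the quadratic remainder bound
     pass to the limit, so [D'] is the differential of [f] at [x]. *)
  have /choice[D' D'P] h : exists l : 'M[C]_2, (fun n => D n h) @ U --> l.
    apply: (@ultra_cvg_mx R nat U (fun n => D n h) (B / rho * `|h|) UU).
    by apply: filterE => n /=; have [_ + _] := DP n; exact.
  apply: (@differentiable_of_remainder C 'M[C]_2 'M[C]_2 f D' x (B / rho)
            (B *+ 2 / rho ^+ 2) (rho / 2)).
  - move=> k u v; apply: cvg_mx_unique (D'P _) _.
    have := @cvg_mxZD C nat U PU k _ _ _ _ (D'P u) (D'P v).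
    by apply: cvg_trans; apply: near_eq_cvg; apply: filterE => n; have [-> _ _] := DP n.
  - by rewrite divr_ge0// ltW.
  - by rewrite divr_ge0 ?mulrn_wge0 ?exprn_ge0// ltW.
  - by rewrite divr_gt0.
  - move=> h; rewrite -[D' h]subr0.
    apply: (@cvg_mx_norm_le R nat U (fun n => D n h)) => //.
    by apply: filterE => n /=; rewrite subr0; have [_ + _] := DP n; exact.
  - move=> h hrho; rewrite -[X in `|X|]subr0.
    apply: (@cvg_mx_norm_le R nat U (fun n => F n (x + h) - F n x - D n h)) => //.
      apply: cvg_mxB => //; apply: cvg_mxB; apply: fP; last exact: A_ball2'.
      by apply: A_ball2 => //; exact: le_trans hrho rho2.
    by apply: filterE => n /=; rewrite subr0; have [_ _] := DP n; exact.
have unif e : 0 < e -> U [set n | forall x, A x -> `|F n x - f x| <= e].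
  move=> e0; have cA := (compact_near_coveringP A).1 (@compact_mx_ball R N rho).
  apply: (cA nat U (fun n x => `|F n x - f x| <= e)) => x Ax.
  (* This gives [d <= rho / 2] and [L d <= e / 4]: moving from [x] to [y] costs [e / 4] for [F n]
     and again for [f], leaving [e / 2] for the error at [x]. *)
  pose d := (2 / rho + L * 4 / e)^-1.
  have d0 : 0 < d by rewrite invr_gt0 ltr_pwDl ?divr_gt0// divr_ge0 ?mulr_ge0// ltW.
  have dinv : d * (2 / rho + L * 4 / e) = 1 by rewrite mulVf// gt_eqF// -invr_gt0.
  have drho : d <= rho / 2.
    have -> : rho / 2 = d * ((2 / rho + L * 4 / e) * (rho / 2)) by rewrite mulrA dinv mul1r.
    rewrite ler_peMr// ?(ltW d0)//.
    have E : 2 / rho * (rho / 2) = 1 by field; rewrite gt_eqF.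
    rewrite mulrDl E lerDl.
    by rewrite !mulr_ge0 ?invr_ge0// ltW.
  have dL : L * d <= e / 4.
    have -> : e / 4 = d * ((2 / rho + L * 4 / e) * (e / 4)) by rewrite mulrA dinv mul1r.
    rewrite [leLHS]mulrC ler_wpM2l ?(ltW d0)//.
    have E : L * 4 / e * (e / 4) = L by field; rewrite gt_eqF.
    rewrite mulrDl E.
    by rewrite lerDr !mulr_ge0 ?invr_ge0// ltW.
  have e2 : 0 < e / 2 by rewrite divr_gt0.
  have /cvg_mxP/(_ _ e2) Fx := fP x (A_ball2' x Ax).
  exists ([set y : 'M[C]_2 | `|y - x| < d], [set n | `|F n x - f x| <= e / 2]).
    by split=> //=; apply/nbhs_mxP; exists d.
  move=> [y n] /= [/ltW yx Fn]; have yrho := le_trans yx drho.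
  have := lipF x (y - x) n Ax yrho; have := lipf x (y - x) Ax yrho; rewrite addrCA subrr addr0.
  move=> /le_trans/(_ (le_trans (ler_wpM2l L0 yx) dL)) l1.
  move=> /le_trans/(_ (le_trans (ler_wpM2l L0 yx) dL)) l2.
  have -> : F n y - f y = (F n y - F n x) + (F n x - f x) - (f y - f x).
    by rewrite addrA subrK opprB addrA subrK.
  rewrite (le_trans (ler_normB _ _))// (le_trans (lerD (ler_normD _ _) (lexx _)))//.
  rewrite (le_trans (lerD (lerD l2 Fn) l1))// le_eqVlt; apply/orP; left; apply/eqP.
  by field.
have extract j m : exists n, (m < n)%N /\ forall x, A x -> `|F n x - f x| <= j.+1%:R^-1.
  have j0 : 0 < j.+1%:R^-1 :> C by rewrite invr_gt0.
  have Um : U [set n | (m < n)%N] by apply: Uoo; exact: nbhs_infty_gt.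
  by have [n [/= ? ?]] := filter_ex (filterI Um (unif _ j0)); exists n.
have [phi phi_incr phiP] := increasing_extraction extract.
exists phi => //; exists f; split=> [M /ltW|]; first exact: diff_f.
apply/fam_cvgP => D [DA cD] V /= /uniform_nbhs[E [entE EV]].
have [e e0 eE] := entourage_norm entE.
have [m me] := natr_gt_complex (gtr0_real (etrans (invr_gt0 e) e0)).
exists m => // k /= mk; apply: EV => y Dy; apply: eE; rewrite distrC.
apply: le_lt_trans (phiP k y _) _; first by apply: ltW; exact: DA.
rewrite -[e]invrK ltf_pV2 ?posrE ?invr_gt0 ?ltr0n//; apply: lt_le_trans me _.
by rewrite ler_nat ltnW.
Qed.

End Montel.
(** * The Fatou set *)

Section NormalFamilies.
Variable R : realType.
Local Notation C := [the numClosedFieldType of R[i]].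
Implicit Types (p q g : {poly C}) (r rho B e : C) (x h M N : 'M[C]_2).

Lemma open_nbhs_mx_ball N rho : 0 < rho -> open_nbhs N [set M : 'M[C]_2 | `|M - N| < rho].
Proof.
move=> rho0; split; last by rewrite /= subrr normr0.
rewrite openE => M /= MN; apply/nbhs_mxP; exists (rho - `|M - N|); first by rewrite subr_gt0.
move=> M' M'M; have := ler_normD (M' - M) (M - N); rewrite subrKA => /le_lt_trans; apply.
by rewrite -ltrBrDr.
Qed.

(** Sequences from the family of iterates carry arbitrary exponents. Either one exponent recurs
    infinitely often, or each value is eventually avoided and, by induction on [m], the exponents
    tend to infinity. *)
Lemma nat_seq_dichotomy (n : nat -> nat) :
  (exists m, exists2 phi, {homo phi : i j / (i < j)%N} & forall k, n (phi k) = m) \/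
  (forall m, exists j, forall k, (j < k)%N -> (m < n k)%N).
Proof.
have [[m mP]|nom] := pselect (exists m, forall j, exists k, (j < k)%N /\ n k = m).
  left; exists m; apply: (@increasing_extraction (fun _ k => n k = m)) => _ j.
  exact: mP.
have ne m : exists j, forall k, (j < k)%N -> n k <> m.
  apply: contrapT => H; apply: nom; exists m => j; apply: contrapT => H'.
  by apply: H; exists j => k jk nk; apply: H'; exists k.
right; elim=> [|m [j jP]].
  by have [j jP] := ne 0%N; exists j => k /jP/eqP; rewrite -lt0n.
have [j' j'P] := ne m.+1; exists (maxn j j') => k; rewrite gtn_max => /andP[/jP mk /j'P/eqP ne_nk].
by rewrite ltn_neqAle eq_sym ne_nk.
Qed.

Lemma ltn_homo_ge (phi : nat -> nat) : {homo phi : i j / (i < j)%N} -> forall k, (k <= phi k)%N.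
Proof. by move=> phiP; elim=> // k /leq_ltn_trans; apply; exact: phiP. Qed.

Lemma holomorphic_matrix_poly q (U : set 'M[C]_2) : holomorphic_on U (matrix_poly q).
Proof. by move=> M _; exact: differentiable_matrix_poly. Qed.

Lemma iter_matrix_polyE p n :
  iter n (matrix_poly p) = matrix_poly (poly_iter p n) :> ('M[C]_2 -> _).
Proof. by apply/funext => M; rewrite iter_matrix_poly. Qed.

Lemma normal_const_subseq p (U : set 'M[C]_2) (s : nat -> 'M[C]_2 -> 'M[C]_2)
    (n phi : nat -> nat) m :
  (forall k, s k = iter (n k) (matrix_poly p)) -> (forall k, n (phi k) = m) ->
  exists f, holomorphic_on U f /\ {family compactly_in U, (s \o phi) @ \oo --> f}.
Proof.
move=> sn nphi; exists (matrix_poly (poly_iter p m)).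
split; first exact: holomorphic_matrix_poly.
apply/fam_cvgP => D _ V /= /uniform_nbhs[E [entE EV]].
exists 0%N => // k _ /=; apply: EV => y _.
by rewrite sn nphi iter_matrix_polyE; exact: entourage_refl.
Qed.

Lemma fatou_preimage p M : fatou_set (matrix_poly p) (matrix_poly p M) ->
  fatou_set (matrix_poly p) (M : 'M[C]_2).
Proof.
move=> [U [[openU UPM] normU]]; exists (matrix_poly p @^-1` U); split.
  split=> //; apply: open_comp => // x _; exact: continuous_matrix_poly.
move=> s sP; have /choice[n nP] k : exists n, (1 <= n)%N /\ s k = iter n (matrix_poly p).
  by have [n n1 <-] := sP k; exists n.
have n_gt0 k := (nP k).1; have sn k := (nP k).2.
have [[m [phi phi_incr phiP]]|nP'] := nat_seq_dichotomy n.
  by exists phi; split=> //; left; exact: normal_const_subseq sn phiP.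
(* Exponents must exceed [1] so that their predecessors stay in the family, which starts at [n = 1];
   dropping the first [j.+1] terms ensures it. *)
have [j jP] := nP' 1%N.
pose s' k := iter (n (k + j.+1)%N).-1 (matrix_poly p) : 'M[C]_2 -> 'M[C]_2.
have s'P k : s (k + j.+1)%N = s' k \o matrix_poly p.
  apply/funext => x; rewrite sn /s' /= -iterSr prednK//; exact: n_gt0.
have [k|phi [phi_incr phiP]] := normU s'.
  exists (n (k + j.+1)%N).-1 => //=.
  by rewrite -ltnS prednK ?jP// ?n_gt0// addnS ltnS leq_addl.
have compact_image D : compactly_in (matrix_poly p @^-1` U) D ->
    compactly_in U (matrix_poly p @` D).
  move=> [DU cD]; split; first by move=> _ [x /DU Ux <-].
  apply: continuous_compact => //.
  by apply: continuous_subspaceT => x; exact: continuous_matrix_poly.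
exists (fun k => phi k + j.+1)%N; split; first by move=> a b ab; rewrite ltn_add2r phi_incr.
case: phiP => [[f [holf sf]]|div]; [left|right].
  exists (f \o matrix_poly p); split.
    move=> x Ux; apply: differentiable_comp; first exact: differentiable_matrix_poly.
    exact: holf.
  apply/fam_cvgP => D cD V /= /uniform_nbhs[E [entE EV]].
  move/fam_cvgP : sf => /(_ _ (compact_image D cD)) sf.
  have nE : nbhs (f : {uniform` matrix_poly p @` D -> 'M[C]_2})
      [set h | forall y, (matrix_poly p @` D) y -> E (f y, h y)].
    by apply/uniform_nbhs; exists E; split.
  have [m _ mP] := sf _ nE; exists m => // k /mP /= kE; apply: EV => y Dy.
  by rewrite s'P /=; apply: kE; exists y.
move=> D cD b breal; apply: filterS (div _ (compact_image D cD) b breal) => k kD M' DM'.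
by rewrite /= s'P; apply: kD; exists M'.
Qed.

End NormalFamilies.

(** * Perturbation and transport of the spectrum *)

Section Spectral.
Variable C : numClosedFieldType.
Implicit Types (p q g : {poly C}) (a b z r e : C) (M N E : 'M[C]_2).

Lemma scalar_mx_norm_le a : `|a%:M : 'M[C]_2| <= `|a|.
Proof. by apply: mx_norm_le => // i j; rewrite mxE; case: eqP; rewrite ?normr0. Qed.

Lemma eigenvalue_2roots M z1 z2 b :
  char_poly M = ('X - z1%:P) * ('X - z2%:P) -> eigenvalue M b = (b == z1) || (b == z2).
Proof. by move=> E; rewrite eigenvalue_root_char E root_XsubCM. Qed.

Lemma horner_mx_XsubC2 M z1 z2 :
  horner_mx M (('X - z1%:P) * ('X - z2%:P)) = (M - z1%:M) *m (M - z2%:M).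
Proof. by rewrite rmorphM !rmorphB /= horner_mx_X !horner_mx_C. Qed.

(* A left eigenvector [v] of [N] nearly satisfies [v M = b v]; applying
   Cayley-Hamilton for [M] to it bounds [(b - z1) (b - z2)] by [|M - N|]. *)
Lemma eigenvalue_near N b e : eigenvalue N b -> 0 < e ->
  exists2 d, 0 < d & forall M, `|M - N| < d -> exists2 b', eigenvalue M b' & `|b' - b| < e.
Proof.
move=> Nb e0; pose c := `|N| + 1; have c1 : 1 <= c by rewrite lerDr.
have c0 : 0 < c := lt_le_trans ltr01 c1.
have bc : `|b| <= c *+ 2.
  by rewrite (le_trans (eigenvalue_norm_le Nb))// lerMn2r/= lerDl.
(* The constant [20 = 4 * 2 + 2 * 3 * 2] collects the estimates [t1] and [t2] below; with
   [d = 1 / s] it gives [20 c d = e ^ 2 - d e ^ 2 < e ^ 2], the contradiction. *)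
have k0 : 0 <= c *+ 20 / e ^+ 2 by rewrite divr_ge0 ?mulrn_wge0 ?exprn_ge0// ltW.
pose s := 1 + c *+ 20 / e ^+ 2; have s1 : 1 <= s by rewrite lerDl.
have s0 : 0 < s := lt_le_trans ltr01 s1.
pose d := s^-1; have d0 : 0 < d by rewrite invr_gt0.
have d1 : d <= 1 by rewrite invf_le1.
have dinv : d * s = 1 by rewrite mulVf// gt_eqF.
exists d => // M MN.
have [z1 [z2 Mz]] := char_poly2 M.
have eig1 : eigenvalue M z1 by rewrite (eigenvalue_2roots _ Mz) eqxx.
have eig2 : eigenvalue M z2 by rewrite (eigenvalue_2roots _ Mz) eqxx orbT.
have [near1|far1] := real_ltP (normr_real (z1 - b)) (gtr0_real e0); first by exists z1.
have [near2|far2] := real_ltP (normr_real (z2 - b)) (gtr0_real e0); first by exists z2.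
exfalso.
have Mc : `|M| <= c.
  rewrite -[M](subrK N) addrC (le_trans (ler_normD _ _))// lerD2l.
  exact: le_trans (ltW MN) d1.
have zc z : eigenvalue M z -> `|z| <= c *+ 2.
  by move=> /eigenvalue_norm_le /le_trans; apply; rewrite lerMn2r.
have /eigenvalueP[v vN v0] := Nb.
have nv : 0 < `|v| by rewrite normr_gt0.
have CH : v *m (M - z1%:M) *m (M - z2%:M) = 0.
  by rewrite -mulmxA -horner_mx_XsubC2 -Mz Cayley_Hamilton mulmx0.
have vM z : v *m (M - z%:M) = (b - z) *: v + v *m (M - N).
  by rewrite !mulmxBr vN mul_mx_scalar scalerBl [RHS]addrC addrA subrK.
have key : (b - z1) * (b - z2) *: v =
    - ((b - z1) *: (v *m (M - N)) + v *m (M - N) *m (M - z2%:M)).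
  apply/eqP; rewrite -addr_eq0 -CH (vM z1) mulmxDl -scalemxAl (vM z2) scalerDr scalerA.
  by rewrite addrA.
have vE : `|v *m (M - N)| <= (`|v| * d) *+ 2.
  by rewrite (le_trans (mulmx_norm_le _ _))// lerMn2r/= ler_wpM2l// ltW.
have bz : `|b - z1| <= c *+ 4.
  by rewrite (le_trans (ler_normB _ _))// (mulrnDr c 2 2) lerD// zc.
have Mz2 : `|M - z2%:M| <= c *+ 3.
  rewrite (le_trans (ler_normB _ _))// (mulrnDr c 1 2) lerD//.
  by rewrite (le_trans (scalar_mx_norm_le _))// zc.
have : e ^+ 2 * `|v| <= (c *+ 20 * d) * `|v|.
  apply: le_trans (_ : `|(b - z1) * (b - z2) *: v| <= _).
    by rewrite normrZ normrM expr2 ler_wpM2r// ler_pM// ?(ltW e0)// distrC.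
  rewrite key normrN (le_trans (ler_normD _ _))//.
  have t1 : `|(b - z1) *: (v *m (M - N))| <= c *+ 4 * ((`|v| * d) *+ 2).
    by rewrite normrZ ler_pM.
  have t2 : `|v *m (M - N) *m (M - z2%:M)| <= ((`|v| * d) *+ 2 * (c *+ 3)) *+ 2.
    by rewrite (le_trans (mulmx_norm_le _ _))// lerMn2r/= ler_pM.
  apply: le_trans (lerD t1 t2) _; rewrite le_eqVlt; apply/orP; left; apply/eqP; ring.
rewrite ler_pM2r//.
have -> : c *+ 20 * d = e ^+ 2 * (d * s) - d * e ^+ 2.
  by rewrite /s; field; rewrite gt_eqF.
by rewrite dinv mulr1; apply/negP; rewrite lt_geF// gtrBl mulr_gt0// exprn_gt0.
Qed.

(** Each factor [X - p(zi)] composed with [p] is divisible by [X - zi]. This transports an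
    annihilating product from [M] to [P(M)], also when the roots coincide. *)
Lemma annihilates_horner p M z1 z2 :
  horner_mx M (('X - z1%:P) * ('X - z2%:P)) = 0 ->
  horner_mx (matrix_poly p M) (('X - (p.[z1])%:P) * ('X - (p.[z2])%:P)) = 0.
Proof.
move=> M0; rewrite -horner_mx_comp_poly comp_polyM !comp_polyB !comp_polyX !comp_polyC.
have factor z : exists g, p - (p.[z])%:P = ('X - z%:P) * g.
  by have [g E] := horner_split p z; exists g; rewrite {1}E addrC addKr.
have [g1 ->] := factor z1; have [g2 ->] := factor z2.
rewrite mulrACA rmorphM /= M0; exact: mul0r.
Qed.

End Spectral.

(** * Escaping and interior spectra give Fatou points *)

Section FatouSet.
Variable R : realType.
Local Notation C := [the numClosedFieldType of R[i]].
Implicit Types (p q g : {poly C}) (a b z r rho B e : C) (M N : 'M[C]_2).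
Variables (p : {poly C}) (r : C).
Hypothesis escape_r : is_escape_radius p r.

Let r1 : 1 <= r := escape_r.1.
Let r0 : 0 < r := escape_radius_gt0 escape_r.

Lemma matrix_poly_near q N e : 0 < e -> exists2 d, 0 < d &
  forall M, `|M - N| < d -> `|matrix_poly q M - matrix_poly q N| < e.
Proof.
move=> e0; have nb : nbhs (matrix_poly q N) [set M : 'M[C]_2 | `|M - matrix_poly q N| < e].
  by apply/nbhs_mxP; exists e.
by have /nbhs_mxP := @continuous_matrix_poly C q N _ nb.
Qed.

Lemma norm_iter_eigenvalue n M a : eigenvalue M a ->
  `|(poly_iter p n).[a]| <= `|iter n (matrix_poly p) M| *+ 2.
Proof.
by move=> Ma; rewrite iter_matrix_poly; apply: eigenvalue_norm_le; exact: eigenvalue_horner.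
Qed.

Lemma escape_unbounded B a : B \is Num.real -> ~ filled p r a ->
  exists n0, forall n, (n0 <= n)%N -> B < `|(poly_iter p n).[a]|.
Proof.
move=> Breal /filledPn-/(_ escape_r)[n0 rn0]; have [m Bm] := natr_gt_complex Breal.
exists (n0 + m)%N => n nm; rewrite -(subnK (leq_trans (leq_addr m n0) nm)) horner_poly_iterD.
apply: le_lt_trans (escape_growth escape_r _ rn0).
apply: le_trans (ltW Bm) _; rewrite -(mulr_natr r) -[leLHS]mul1r ler_pM// ler_nat.
have mn : (m <= n - n0)%N by rewrite leq_subRL// (leq_trans (leq_addr m n0)).
exact: leq_trans mn (ltnW (ltn_expl _ _)).
Qed.

(** Some iterate [P^n0(N)] has an eigenvalue of modulus above [r]. By continuity of [P^n0] and of
    the spectrum, so has [P^n0(M)] for all [M] near [N]; from then on doubling bounds the norms from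
    below uniformly in [M]. *)
Lemma fatou_escape N a : eigenvalue N a -> ~ filled p r a -> fatou_set (matrix_poly p) N.
Proof.
move=> Na /filledPn-/(_ escape_r)[n0 rn0].
have PNa := eigenvalue_horner (poly_iter p n0) Na.
have gap : 0 < `|(poly_iter p n0).[a]| - r by rewrite subr_gt0.
have [d d0 dP] := eigenvalue_near PNa gap.
have [rho rho0 rhoP] := matrix_poly_near (poly_iter p n0) N d0.
exists [set M : 'M[C]_2 | `|M - N| < rho]; split; first exact: open_nbhs_mx_ball.
move=> s sP; have /choice[n nP] k : exists n, s k = iter n (matrix_poly p).
  by have [n n1 <-] := sP k; exists n.
have [[m [phi phi_incr phiP]]|n_oo] := nat_seq_dichotomy n.
  by exists phi; split=> //; left; exact: normal_const_subseq nP phiP.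
exists id; split=> //; right => D [DU cD] b breal.
(* The bound is doubled because an eigenvalue is controlled by twice the norm. *)
have b2real : b *+ 2 \is Num.real by rewrite rpredMn.
have [m bm] := natr_gt_complex b2real.
have [j jP] := n_oo (n0 + m)%N; exists j.+1 => // k /= jk M /DU/rhoP/dP[b' Mb' b'near].
have rb' : r < `|b'|.
  have := ler_normD ((poly_iter p n0).[a] - b') b'; rewrite subrK distrC.
  by rewrite ltrBrDr in b'near; move=> /(lt_le_trans b'near); rewrite ltrD2l.
have nk : (n0 + m < n k)%N by exact: jP.
rewrite nP -(subnK (ltnW (leq_ltn_trans (leq_addr m n0) nk))) iterD (iter_matrix_poly p n0).
suff : b *+ 2 < `|iter (n k - n0) (matrix_poly p) (matrix_poly (poly_iter p n0) M)| *+ 2.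
  by rewrite ltrMn2r.
apply: lt_le_trans (norm_iter_eigenvalue _ Mb').
apply: lt_trans (escape_growth escape_r _ rb'); apply: lt_le_trans bm _.
rewrite -(mulr_natr r) -[leLHS]mul1r ler_pM// ler_nat.
have mn : (m <= n k - n0)%N by rewrite leq_subRL ltnW// (leq_ltn_trans (leq_addr m n0)).
exact: leq_trans mn (ltnW (ltn_expl _ _)).
Qed.

(** With [chi = (X - z1)(X - z2)] one has [chi(N) = 0], so for [M] near [N] each eigenvalue [w] has
    small [|(w - z1)(w - z2)|] and lies near [z1] or [z2]. A disc about [w] of radius independent of
    [M] is then filled, which bounds the divided differences. *)
Lemma iter_bounded_interior N z1 z2 :
  horner_mx N (('X - z1%:P) * ('X - z2%:P)) = 0 ->
  filled_interior p r z1 -> filled_interior p r z2 ->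
  exists2 d, 0 < d & exists B, forall n M, `|M - N| <= d ->
    `|matrix_poly (poly_iter p n) M| <= B.
Proof.
move=> N0 [e1 e10 K1] [e2 e20 K2].
have [e' [e'0 e'1 e'2]] := pos_lower_bound e10 e20.
pose e := e' / 2; have e0 : 0 < e by rewrite divr_gt0.
have ee : e + e = e' by rewrite -splitr.
pose chi := ('X - z1%:P) * ('X - z2%:P).
have chi0 : matrix_poly chi N = 0 by exact: N0.
have [d d0] := matrix_poly_near chi N (divr_gt0 (exprn_gt0 2 e0) (ltr0Sn C 1)).
rewrite chi0 => dP.
have [d' [d'0 d'1 d'd]] := pos_lower_bound (ltr01 : 0 < 1 :> C) (divr_gt0 d0 (ltr0Sn C 1)).
(* Here [r] bounds the scalar part, [4 r / e] the divided difference, and the last factor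
   [M - w1]. *)
exists d' => //; exists (r + r *+ 4 / e * (`|N| + 1 + r)) => n M MN.
have chiM : `|horner_mx M chi| *+ 2 < e ^+ 2.
  rewrite -(mulr_natr `|horner_mx M chi|) -ltr_pdivlMr// -[horner_mx M chi]subr0; apply: dP.
  by rewrite (le_lt_trans (le_trans MN d'd))// ltr_pdivrMr// ltr_pMr// ltr1n.
have near_filled w : eigenvalue M w -> forall z, `|z - w| <= e -> filled p r z.
  move=> /(eigenvalue_horner chi)/eigenvalue_norm_le/le_lt_trans/(_ chiM).
  rewrite hornerM !hornerXsubC normrM => prod_lt z zw.
  have close zi ei : e' <= ei -> `|w - zi| < e -> `|z - zi| < ei.
    move=> e'i wzi; apply: lt_le_trans e'i; rewrite -ee.
    have := ler_normD (z - w) (w - zi); rewrite subrKA => /le_lt_trans; apply.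
    exact: ler_ltD.
  have [near1|far1] := real_ltP (normr_real (w - z1)) (gtr0_real e0).
    by apply: K1; exact: close near1.
  have [near2|far2] := real_ltP (normr_real (w - z2)) (gtr0_real e0).
    by apply: K2; exact: close near2.
  by move: prod_lt; rewrite le_gtF// expr2 ler_pM// ltW.
have [w1 [w2 Mw]] := char_poly2 M.
have eig1 : eigenvalue M w1 by rewrite (eigenvalue_2roots _ Mw) eqxx.
have eig2 : eigenvalue M w2 by rewrite (eigenvalue_2roots _ Mw) eqxx orbT.
have Kw1 : filled p r w1 by apply: near_filled eig1 _ _; rewrite subrr normr0 ltW.
have Kw2 : filled p r w2 by apply: near_filled eig2 _ _; rewrite subrr normr0 ltW.
have [g gE] := horner_split (poly_iter p n) w1.
have M0 : horner_mx M (('X - w1%:P) * ('X - w2%:P)) = 0 by rewrite -Mw Cayley_Hamilton.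
rewrite /matrix_poly (horner_mx_2roots M0 gE).
apply: le_trans (ler_normD _ _) _; apply: lerD.
  by rewrite (le_trans (scalar_mx_norm_le _)).
rewrite normrZ ler_pM//.
  by apply: divided_difference_bound gE => // [|z zw]; [exact: ltW|exact: near_filled zw n].
apply: le_trans (ler_normB _ _) _; apply: lerD.
  rewrite -[M](subrK N) addrC (le_trans (ler_normD _ _))// lerD2l.
  exact: le_trans MN d'1.
by rewrite (le_trans (scalar_mx_norm_le _))//; have := Kw1 0%N; rewrite hornerX.
Qed.

Lemma fatou_interior N z1 z2 :
  horner_mx N (('X - z1%:P) * ('X - z2%:P)) = 0 ->
  filled_interior p r z1 -> filled_interior p r z2 -> fatou_set (matrix_poly p) N.
Proof.
move=> N0 K1 K2; have [d d0 [B dB]] := iter_bounded_interior N0 K1 K2.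
have d20 : 0 < d / 2 by rewrite divr_gt0.
exists [set M : 'M[C]_2 | `|M - N| < d / 2]; split; first exact: open_nbhs_mx_ball.
move=> s sP; have /choice[n nP] k : exists n, s k = matrix_poly (poly_iter p n).
  by have [n n1 <-] := sP k; exists n; exact: iter_matrix_polyE.
have [k M MN|phi phi_incr [f [holf cvgf]]] :=
    @montel_matrix_poly R (fun k => poly_iter p (n k)) N (d / 2) B d20.
  by apply: dB; rewrite mulr2n -splitr in MN.
exists phi; split=> //; left; exists f; split=> //.
by rewrite (_ : s \o phi = fun k => matrix_poly (poly_iter p (n (phi k)))) //; apply/funext => k /=.
Qed.

End FatouSet.

(** * Spectra of Fatou points *)

Section FatouSpectrum.
Variable R : realType.
Local Notation C := [the numClosedFieldType of R[i]].
Implicit Types (q g : {poly C}) (a b z e B : C) (M N : 'M[C]_2).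
Variables (p : {poly C}) (r : C).
Hypothesis escape_r : is_escape_radius p r.
Hypothesis size_p : (2 < size p)%N.

Let r0 : 0 < r := escape_radius_gt0 escape_r.

(** The divided difference of [p^n] is here a quotient with numerator at most [2 r] and a nonzero
    denominator independent of [n]. *)
Lemma iter_bounded_distinct M z1 z2 :
  horner_mx M (('X - z1%:P) * ('X - z2%:P)) = 0 -> z1 != z2 ->
  filled p r z1 -> filled p r z2 ->
  exists2 B, B \is Num.real & forall n, `|iter n (matrix_poly p) M| <= B.
Proof.
move=> M0 z12 K1 K2.
exists (r + (r + r) / `|z2 - z1| * `|M - z1%:M|).
  by rewrite ger0_real// addr_ge0 ?mulr_ge0 ?addr_ge0 ?invr_ge0// ltW.
move=> n; rewrite iter_matrix_poly; have [g gE] := horner_split (poly_iter p n) z1.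
rewrite /matrix_poly (horner_mx_2roots M0 gE) (le_trans (ler_normD _ _))// lerD//.
  by rewrite (le_trans (scalar_mx_norm_le _)).
rewrite normrZ ler_wpM2r// ler_pdivlMr ?normr_gt0 ?subr_eq0 1?eq_sym//.
have -> : `|g.[z2]| * `|z2 - z1| = `|(poly_iter p n).[z2] - (poly_iter p n).[z1]|.
  by rewrite {1}gE hornerD hornerC hornerM hornerXsubC -normrM mulrC addrAC subrr add0r.
by rewrite (le_trans (ler_normB _ _))// lerD.
Qed.

Lemma divergent_bounded_orbit (A : set 'M[C]_2) (phi : nat -> nat) M B :
  compactly_divergent A (fun k => iter (phi k) (matrix_poly p)) -> A M ->
  B \is Num.real -> ~ (forall n, `|iter n (matrix_poly p) M| <= B).
Proof.
move=> div AM Breal bnd.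
have cM : compactly_in A [set M] by split; [move=> _ -> | exact: compact_set1].
have [k kP] := filter_ex (div _ cM B Breal).
by have := kP M erefl; rewrite le_gtF.
Qed.

(* With [N' = N - a] and [E = N' *m pinvmx N'], the matrices [N + (z - a) E] have
   eigenvalues [a] and [z], so [P^n] at them is [p^n(a) + g(z) (N' + (z - a) E)],
   where [g] is the divided difference of [p^n] at [a].  Divergence makes [g]
   large on a disc around [a]; by [min_modulus] [p^n] then covers the filled
   Julia set from that disc, which produces some [z <> a] with bounded orbit. *)
Lemma divergent_nilpotent_part N a rho (phi : nat -> nat) : 0 < rho ->
  horner_mx N (('X - a%:P) * ('X - a%:P)) = 0 -> filled p r a -> (forall k, (0 < phi k)%N) ->
  ~ compactly_divergent [set M : 'M[C]_2 | `|M - N| < rho]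
      (fun k => iter (phi k) (matrix_poly p)).
Proof.
move=> rho0 N0 Ka phi0 div.
(* [E] is idempotent with [E N' = N'] and [N' E = 0], the relations that make [(Mz z - a)(Mz z - z)]
   vanish for every [z]. *)
pose N' := N - a%:M; pose E := N' *m pinvmx N'.
have N'N' : N' *m N' = 0 by rewrite -horner_mx_XsubC2.
have EN' : E *m N' = N' by rewrite /E mulmxKpV.
have N'E : N' *m E = 0 by rewrite /E mulmxA N'N' mul0mx.
have EE : E *m E = E by rewrite {2}/E mulmxA EN'.
pose Mz z := N + (z - a) *: E.
have Mz0 z : horner_mx (Mz z) (('X - a%:P) * ('X - z%:P)) = 0.
  rewrite horner_mx_XsubC2 /Mz addrAC -/N'.
  have -> : N + (z - a) *: E - z%:M = N' + (z - a) *: E - (z - a)%:M.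
    by rewrite /N' raddfB/= opprB [N - _ + _]addrAC subrKA.
  rewrite mulmxBr mul_mx_scalar mulmxDl (mulmxDr N' N') (mulmxDr _ N') N'N'.
  rewrite -!scalemxAl -!scalemxAr N'E EN' EE scaler0 !add0r.
  by rewrite -scalerDr subrr.
(* [W] bounds [|Mz z - a|] for [|z - a| <= 1]; the summand [1] keeps it positive even when
   [N' = 0]. *)
pose W := `|N'| + `|E| + 1; have W0 : 0 < W by rewrite ltr_wpDl ?addr_ge0.
pose rho' := rho / 2; have rho'0 : 0 < rho' by rewrite divr_gt0.
have [d [d0 d1 dW]] := pos_lower_bound (ltr01 : 0 < 1 :> C) (divr_gt0 rho'0 W0).
pose D := [set M : 'M[C]_2 | `|M - N| <= rho'].
have MzD z : `|z - a| <= d -> D (Mz z).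
  move=> za; rewrite /D /= /Mz addrAC subrr add0r normrZ.
  rewrite (le_trans (ler_wpM2r _ (le_trans za dW)))//.
  rewrite mulrAC ler_pdivrMr// ler_wpM2l ?(ltW rho'0)//.
  by rewrite /W -addrA addrCA lerDl addr_ge0.
have rho'rho : rho' < rho by rewrite ltr_pdivrMr// ltr_pMr// ltr1n.
have DU : D `<=` [set M : 'M[C]_2 | `|M - N| < rho].
  by move=> M /= /le_lt_trans; apply.
(* On the circle [|z - a| = d] this yields [|q(z) - w| >= 6 r - 2 r = 4 r], twice the bound [2 r]
   for [|q(a) - w|], as [min_modulus] requires. *)
pose G := r *+ 6 / d.
have G0 : 0 < G by rewrite divr_gt0// pmulrn_lgt0.
have breal : r + G * W \is Num.real by rewrite gtr0_real// addr_gt0// mulr_gt0.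
have [k kP] := filter_ex (div D (conj DU (@compact_mx_ball R N rho')) _ breal).
pose q := poly_iter p (phi k); have [g gE] := horner_split q a.
have gG z : `|z - a| <= d -> G < `|g.[z]|.
  move=> za; have := kP _ (MzD z za); rewrite iter_matrix_poly.
  rewrite /matrix_poly (horner_mx_2roots (Mz0 z) gE) => /lt_le_trans/(_ (ler_normD _ _)).
  have qa : `|(q.[a])%:M : 'M[C]_2| <= r by exact: le_trans (scalar_mx_norm_le _) (Ka _).
  move=> /lt_le_trans/(_ (lerD qa (lexx _))); rewrite ltrD2l normrZ.
  have MW : `|Mz z - a%:M| <= W.
    rewrite /Mz addrAC -/N' (le_trans (ler_normD _ _))// /W -addrA lerD// normrZ.
    by rewrite (le_trans (ler_piMl _ (le_trans za d1)))// lerDl.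
  by move=> /lt_le_trans/(_ (ler_wpM2l (normr_ge0 _) MW)); rewrite ltr_pM2r.
have ga : g.[a] != 0 by rewrite -normr_gt0 (lt_trans G0)// gG// subrr normr0 ltW.
have qz z : q.[z] = q.[a] + (z - a) * g.[z].
  by rewrite {1}gE hornerD hornerC hornerM hornerXsubC.
(* A filled target [w != q(a)] forces its preimage to differ from [a]. If [q] fixes [a], a zero [c]
   of [g] serves: [q(c) = q(a) = a] makes [c] filled, and [g(a) != 0] keeps it off [a]. *)
have [w Kw wqa] : exists2 w, filled p r w & w != q.[a].
  have [qaa|] := eqVneq q.[a] a; last by move=> qaa; exists a; rewrite // eq_sym.
  have sq : (2 < size q)%N by rewrite /q -(prednK (phi0 k)) size_poly_iter.
  have /closed_rootP[c gc] : size g != 1%N.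
    apply/eqP => g1; move: sq; rewrite gE ltnNge => /negP; apply.
    apply: leq_trans (size_polyD _ _) _; rewrite geq_max.
    rewrite (leq_trans (size_polyC_leq1 _))//=.
    by rewrite (leq_trans (size_polyMleq _ _))// g1 size_XsubC.
  have ca : c != a by apply: contra ga => /eqP <-.
  exists c; last by rewrite qaa.
  apply/(filled_poly_iter escape_r (phi k)); rewrite -/q qz (eqP gc) mulr0 addr0.
  exact/(filled_poly_iter escape_r (phi k)).
have qar : `|q.[a] - w| <= r *+ 2.
  rewrite (le_trans (ler_normB _ _))// mulr2n lerD//; first exact: Ka.
  by have := Kw 0%N; rewrite hornerX.
have [||z zq|z za /rootP] := @min_modulus C (q - w%:P) a d (r *+ 4) d0.
- by rewrite pmulrn_lgt0.
- by rewrite hornerD hornerN hornerC (mulrnA r 2 2) lerMn2r.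
- rewrite hornerD hornerN hornerC qz addrAC addrC.
  apply: le_trans (lerB_normD _ _); rewrite lerBrDr.
  apply: le_trans (lerD (lexx _) qar) _; rewrite -mulrnDr normrM zq mulrC -ler_pdivrMr//.
  by rewrite ltW// gG// zq.
rewrite hornerD hornerN hornerC => /eqP; rewrite subr_eq0 => /eqP qzw.
have Kz : filled p r z by apply/(filled_poly_iter escape_r (phi k)); rewrite -/q qzw.
have az : a != z by apply: contra wqa => /eqP ->; rewrite qzw.
have [B Breal bnd] := iter_bounded_distinct (Mz0 z) az Ka Kz.
exact: (divergent_bounded_orbit div (DU _ (MzD z (ltW za))) Breal bnd).
Qed.

(** Normality is tested on the full sequence of iterates. A convergent subsequence is impossible if
    [a] is a limit of escaping points, and a divergent one because [N], or a matrix near it, has a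
    bounded orbit. *)
Lemma fatou_eigenvalue N : fatou_set (matrix_poly p) N ->
  (forall a, eigenvalue N a -> filled p r a) ->
  forall a, eigenvalue N a -> filled_interior p r a.
Proof.
move=> [U [[openU UN] normU]] NK a Na; apply: contrapT => not_int.
have /nbhs_mxP[rho rho0 rhoU] : nbhs N U by exact: open_nbhs_nbhs.
have [k|phi [phi_incr]] := normU (fun k => iter k.+1 (matrix_poly p)); first by exists k.+1.
have phi_ge := ltn_homo_ge phi_incr.
case=> [[f [_ cvgf]]|div].
  have [z za nKz] : exists2 z, `|z - a| < rho & ~ filled p r z.
    apply: contrapT => H; apply: not_int; exists rho => // z za.
    by apply: contrapT => nK; apply: H; exists z.
  (* A scalar shift moves the eigenvalue [a] to the escaping point [z] while staying in [U]. *)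
  pose M := N + (z - a)%:M.
  have UM : U M.
    by apply: rhoU; rewrite /M addrAC subrr add0r (le_lt_trans (scalar_mx_norm_le _)).
  have Mz : eigenvalue M z.
    case/eigenvalueP: Na => v vN v0; apply/eigenvalueP; exists v => //.
    by rewrite mulmxDr vN mul_mx_scalar -scalerDl addrC subrK.
  have cM : compactly_in U [set M] by split; [move=> _ -> | exact: compact_set1].
  move/fam_cvgP : cvgf => /(_ _ cM) cvgf.
  have nE : nbhs (f : {uniform` [set M] -> 'M[C]_2})
      [set h | `|h M - f M| < 1].
    apply/uniform_nbhs; exists [set xy : 'M[C]_2 * 'M[C]_2 | `|xy.1 - xy.2| < 1]; split.
      by rewrite -entourage_ballE; exists 1 => //= -[x y] /=; rewrite mx_norm_ball.
    by move=> h /= /(_ M erefl); rewrite distrC.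
  have [m _ mP] := cvgf _ nE.
  have Breal : (`|f M| + 1) *+ 2 \is Num.real by rewrite ger0_real ?mulrn_wge0 ?addr_ge0.
  have [n0 n0P] := escape_unbounded escape_r Breal nKz.
  have := mP (maxn m n0) (leq_maxl _ _) => /= near_f.
  have := n0P (phi (maxn m n0)).+1 (leq_trans (leq_maxr m n0) (leqW (phi_ge _))).
  apply/negP; rewrite le_gtF// (le_trans (norm_iter_eigenvalue _ _ Mz))// lerMn2r/=.
  rewrite -[X in `|X|](subrK (f M)) addrC (le_trans (ler_normD _ _))// lerD2l.
  exact: ltW.
have [z1 [z2 Nz]] := char_poly2 N.
have N0 : horner_mx N (('X - z1%:P) * ('X - z2%:P)) = 0 by rewrite -Nz Cayley_Hamilton.
have K1 : filled p r z1 by apply: NK; rewrite (eigenvalue_2roots _ Nz) eqxx.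
have K2 : filled p r z2 by apply: NK; rewrite (eigenvalue_2roots _ Nz) eqxx orbT.
(* For distinct roots the orbit of [N] itself is bounded. For a double root [N] may be a Jordan
   block with unbounded orbit, and nearby matrices are used instead. *)
have [z12|z12] := eqVneq z1 z2; last first.
  have [B Breal bnd] := iter_bounded_distinct N0 z12 K1 K2.
  exact: (divergent_bounded_orbit (phi := fun k => (phi k).+1) div UN Breal bnd).
rewrite -z12 in N0.
apply: (@divergent_nilpotent_part N z1 rho (fun k => (phi k).+1)) => // D [DB cD].
by apply: div; split=> // M /DB /rhoU.
Qed.

End FatouSpectrum.

Theorem corollary3p7 (R : realType) (p : {poly R[i]}) (hp : (2 < size p)%N) :
  completely_invariant (matrix_poly p) (julia_set (matrix_poly p)) /\
  completely_invariant (matrix_poly p) (fatou_set (matrix_poly p)).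
Proof.
suff inv : completely_invariant (matrix_poly p) (fatou_set (matrix_poly p)).
  by split=> // M; split=> notF F; apply: notF; [exact: (inv M).2|exact: (inv M).1].
move=> M; split; last exact: (@fatou_preimage R p M).
have [r r1 rP] := escape_radius hp; have escape_r : is_escape_radius p r by [].
move=> FM; have [[a Ma nKa]|all_filled] := pselect (exists2 a, eigenvalue M a & ~ filled p r a).
  apply: (@fatou_escape R p r escape_r _ p.[a]); first exact: eigenvalue_horner.
  by move/(filled_horner escape_r).
have [z1 [z2 Mz]] := char_poly2 M.
have interior z : eigenvalue M z -> filled_interior p r p.[z].
  move=> Mz'; apply: filled_interior_horner => //; first exact: ltnW.
  apply: (@fatou_eigenvalue R p r escape_r hp M FM) => // a Ma.
  by apply: contrapT => nK; apply: all_filled; exists a.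
apply: (@fatou_interior R p r escape_r _ p.[z1] p.[z2]).
- by apply: annihilates_horner; rewrite -Mz Cayley_Hamilton.
- by apply: interior; rewrite (eigenvalue_2roots _ Mz) eqxx.
- by apply: interior; rewrite (eigenvalue_2roots _ Mz) eqxx orbT.
Qed.
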